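(* Let $x(\cdot)\in\mathcal{M}\cup\mathcal{N}\cup\mathcal{X}(2)$ be such that $x(t)=0$ for $t<0$. Then $x(t)\equiv 0$ on $\mathbb{R}$.
   Context: All functions are real-valued functions on $\mathbb{R}$. Elements of $L_1(\mathbb{R})\cup L_2(\mathbb{R})$ are identified as usual when they are equal almost everywhere; accordingly, for $x(\cdot)\in\mathcal{X}(2)$ the equalities $x(t)=0$ for $t<0$ and $x\equiv 0$ are understood up to almost everywhere equality. For $C>0$, $\mathcal{M}(C)$ is the class of infinitely differentiable functions $x:\mathbb{R}\to\mathbb{R}$ for which there exists $M=M(x(\cdot))>0$ such that $$\left\|\frac{d^kx}{dt^k}\right\|^2_{L_2(\mathbb{R})}\le C^kM\quad\text{for all } k=0,2,4,6,\dots$$ For $C>0$, $\mathcal{N}(C)$ is the class of infinitely differentiable functions $x:\mathbb{R}\to\mathbb{R}$ for which there exists $M=M(x(\cdot))>0$ such that $$\frac12\left(\left\|\frac{d^{k-1}x}{dt^{k-1}}\right\|^2_{L_2(\mathbb{R})}+\left\|\frac{d^{k+1}x}{dt^{k+1}}\right\|^2_{L_2(\mathbb{R})}\right)\le k!\,C^{-k}M\quad\text{for all } k=1,3,5,7,\dots$$ For $T>0$, $\mathcal{X}(2,T)$ is the set of $x(\cdot)\in L_2(\mathbb{R})\cup L_1(\mathbb{R})$ such that $$\int_{-\infty}^{+\infty}e^{2T|\omega|}\,|X(i\omega)|^2\,d\omega<+\infty,$$ where $X(i\omega)$, $\omega\in\mathbb{R}$, is the Fourier transform of $x$, i.e. $X(i\omega)=\int_{-\infty}^{+\infty}e^{-i\omega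 t}x(t)\,dt$ for $x\in L_1(\mathbb{R})$, and the usual $L_2$ (Plancherel) extension for $x\in L_2(\mathbb{R})$. Finally, $\mathcal{M}=\bigcup_{C>0}\mathcal{M}(C)$, $\mathcal{N}=\bigcup_{C>0}\mathcal{N}(C)$, and $\mathcal{X}(2)=\bigcup_{T>0}\mathcal{X}(2,T)$. *)

(* Defs.v *)
From HB Require Import structures.
From mathcomp Require Import all_boot all_order all_algebra.
From mathcomp Require Import all_classical all_reals all_analysis.
From mathcomp Require Import complex.

Set Implicit Arguments.
Unset Strict Implicit.
Unset Printing Implicit Defensive.

Import Order.TTheory GRing.Theory Num.Theory.
Import numFieldNormedType.Exports.

Local Open Scope ring_scope.
Local Open Scope classical_set_scope.

Section Defs.
Context {R : realType}.
Local Notation mu := (@lebesgue_measure R).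

Definition smooth (x : R -> R) : Prop :=
  forall (k : nat) (t : R), derivable x^`(k) t 1.

(* Extended-real valued: [+oo] when [f] is not square integrable. *)
Definition sqnorm2 (f : R -> R) : \bar R := ('N[mu]_2%:E[EFin \o f] ^+ 2)%E.

Definition classM_ (C : R) : set (R -> R) := [set x | smooth x /\
  exists2 M : R, 0 < M & forall k : nat, ~~ odd k ->
    (sqnorm2 x^`(k) <= (C ^+ k * M)%:E)%E].

Definition classN_ (C : R) : set (R -> R) := [set x | smooth x /\
  exists2 M : R, 0 < M & forall k : nat, odd k ->
    (2^-1%:E * (sqnorm2 x^`(k.-1) + sqnorm2 x^`(k.+1))
       <= (k`!%:R * C ^- k * M)%:E)%E].

Definition cintegral (f : R -> R[i]) : R[i] :=
  Complex (\int[mu]_t complex.Re (f t))%R (\int[mu]_t complex.Im (f t))%R.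

(* e^{-ia} *)
Definition expNi (a : R) : R[i] := (cos a -i* sin a)%C.

(* The Fourier integral [X(iw)]; meaningful for [x] in L1. *)
Definition fourier1 (x : R -> R) (w : R) : R[i] :=
  cintegral (fun t => expNi (w * t) * (x t)%:C%C).

Definition cLfun2 (X : R -> R[i]) : Prop :=
  (fun w => complex.Re (X w)) \in Lfun mu 2%:E /\
  (fun w => complex.Im (X w)) \in Lfun mu 2%:E.

Definition cdist2 (X Y : R -> R[i]) : \bar R :=
  'N[mu]_2%:E[EFin \o (fun w => Normc.normc (X w - Y w)%R)]%E.

(* The L2 Fourier transform is the extension by continuity, in L2 norm, of
   [fourier1] restricted to the dense subspace formed by the intersection of
   L1 and L2.  It is only determined up to equality almost everywhere, whence
   a relation: the pairs [(x, X)] that are L2-limits of pairs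
   [(u n, fourier1 (u n))] with [u n] in L1 and L2. *)
Definition is_fourier2 (x : R -> R) (X : R -> R[i]) : Prop :=
  [/\ x \in Lfun mu 2%:E, cLfun2 X &
   exists u : nat -> R -> R,
   [/\ forall n, u n \in Lfun mu 1%:E /\ u n \in Lfun mu 2%:E,
       'N[mu]_2%:E[EFin \o (u n \- x)%R]%E @[n --> \oo] --> 0%E &
       cdist2 (fourier1 (u n)) X @[n --> \oo] --> 0%E]].

(* Membership in [Lfun] includes Borel measurability: a class of L1 or L2 modulo
   equality almost everywhere is represented by a Borel function. *)
Definition is_fourier (x : R -> R) (X : R -> R[i]) : Prop :=
  (x \in Lfun mu 1%:E /\ X = fourier1 x) \/ is_fourier2 x X.

Definition classX2_ (T : R) : set (R -> R) := [set x |
  exists2 X : R -> R[i], is_fourier x X &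
    (\int[mu]_w (expR (2 * T * `|w|) * Normc.normc (X w) ^+ 2)%:E
       < +oo)%E].

Definition classM : set (R -> R) := \bigcup_(C in [set C | 0 < C]) classM_ C.
Definition classN : set (R -> R) := \bigcup_(C in [set C | 0 < C]) classN_ C.
Definition classX2 : set (R -> R) := \bigcup_(T in [set T | 0 < T]) classX2_ T.

End Defs.

(* Main.v *)
(** A smooth function that vanishes on the negative half-line has all its
derivatives equal to [0] at the origin.  If moreover its derivatives of order
[m] are [O (m! / r ^ m)] for infinitely many [m], Taylor's formula at the right
end of the interval where it is already known to vanish extends that interval
by [r / 2], so the function vanishes everywhere.  For the classes M and N the
bound comes from [|f t| <= (t + ||f'||^2) / 2], valid for [t >= 0] when
[f 0 = 0].

For X(2), write the Fourier transform as [X = A + i B] and put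
[y s = \int (A w cos (w s) - B w sin (w s)) dw], which is [2 pi] times the
inverse transform.  The weight [e^(2T|w|)] gives [y] derivatives of factorial
growth.  Damping by [e^(-e|w|)] and exchanging integrals (a passage to the limit
in L2) yields the Poisson formula
[\int e^(-e|w|) (A w cos (w s) - B w sin (w s)) dw
   = \int x t * 2e / (e^2 + (t - s)^2) dt].
For [s < 0] the right-hand side tends to [0] with [e], since [x] lives on
[t > 0]; hence [y = 0] on the negative half-line, and so everywhere.
Integrating the formula over [s] in [[0, b]] and letting [e] tend to [0], the
left-hand side tends to [0] and the right-hand side to [2 pi \int_0^b x].  By
Lebesgue's differentiation theorem [x = 0] almost everywhere. *)
Require Import Defs.
From mathcomp Require Import all_boot all_order all_algebra.
From mathcomp Require Import all_classical all_reals all_analysis.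
From mathcomp Require Import measurable_realfun complex ring lra.
Import Order.TTheory GRing.Theory Num.Theory.
Import numFieldNormedType.Exports.
Local Open Scope classical_set_scope.
Local Open Scope ring_scope.

Set Implicit Arguments.
Unset Strict Implicit.
Unset Printing Implicit Defensive.

(** * Functions with derivatives of factorial growth *)

Section taylor.
Context {R : realType}.
Implicit Types (A B f g h x : R -> R) (F D : nat -> R -> R).

Lemma is_derive_continuous {f} {df t : R} : is_derive t 1 f df -> {for t, continuous f}.
Proof.
by move=> fd; apply/differentiable_continuous/derivable1_diffP; case: fd.
Qed.

Lemma le_of_derive_le f g (df dg : R -> R) (a b : R) :
  (forall t : R, is_derive t 1 f (df t)) -> (forall t : R, is_derive t 1 g (dg t)) ->
  f a = 0 -> g a = 0 -> (forall t, a <= t <= b -> df t <= dg t) ->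
  forall t, a <= t <= b -> f t <= g t.
Proof.
move=> fd gd fa ga le t /andP[at_ tb].
have hd (s : R) : is_derive s 1 (g \- f) (dg s - df s).
  have := fd s; have := gd s => ? ?; exact: is_deriveB.
rewrite -subr_ge0.
have := @ger0_derive1_ndecr R (g \- f) a t _ _ _ a t (lexx _) at_ (lexx _).
rewrite /= fa ga subrr; apply => //.
- move=> s; rewrite in_itv /= => /andP[as_ st].
  rewrite derive1E (@derive_val _ _ _ _ _ _ _ (hd s)) subr_ge0 le //.
  by rewrite (ltW as_) (le_trans (ltW st)).
- apply: continuous_subspaceT => s; exact: is_derive_continuous (hd s).
Qed.

(** Induction on [n] with the shifted sequence [F k.+1]: the bound on [F 1] is the derivative of the
    bound wanted for [F 0], so comparing derivatives for [F 0] and [- F 0] replaces an integral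
    remainder. *)
Lemma taylor_bound F (a b K : R) (n : nat) :
  (forall k (t : R), is_derive t 1 (F k) (F k.+1 t)) -> (forall k, F k a = 0) ->
  (forall t, a <= t <= b -> `|F n t| <= K) ->
  forall t, a <= t <= b -> `|F 0%N t| <= K * (t - a) ^+ n / n`!%:R.
Proof.
elim: n F => [F _ _ h t tab|n IH F Fd Fa h t tab].
  by rewrite expr0 fact0 mulr1 divr1; exact: h.
have {}IH := IH (fun k => F k.+1) (fun k => Fd k.+1) (fun k => Fa k.+1) h.
pose g s := K * (s - a) ^+ n.+1 / n.+1`!%:R.
have gd (s : R) : is_derive s 1 g (K * (s - a) ^+ n / n`!%:R).
  have -> : g = (K / n.+1`!%:R) *: ((@id R \- cst a) ^+ n.+1).
    by apply/funext => u; rewrite /g !fctE /= [RHS]mulrAC.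
  apply: is_derive_eq; rewrite /= subr0 /GRing.scale /= mulr1.
  have f0 : n`!%:R != 0 :> R by rewrite pnatr_eq0 -lt0n fact_gt0.
  have f1 : n.+1%:R != 0 :> R by rewrite pnatr_eq0.
  rewrite factS natrM; field.
  by rewrite f0 addrC natr1 f1.
have ga : g a = 0 by rewrite /g subrr expr0n /= mulr0 mul0r.
rewrite ler_norml; apply/andP; split.
- have nd (s : R) : is_derive s 1 (fun s => - F 0%N s) (- F 1%N s).
    by have := Fd 0%N s => ?; exact: is_deriveN.
  rewrite lerNl; apply: (le_of_derive_le nd gd _ ga _ tab); first by rewrite Fa oppr0.
  by move=> s sab; have := IH s sab; rewrite ler_norml => /andP[]; rewrite lerNl.
- apply: (le_of_derive_le (Fd 0%N) gd (Fa _) ga _ tab) => s sab.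
  by have := IH s sab; rewrite ler_norml => /andP[].
Qed.

(** To the left of [a] each derivative is that of a locally zero function; the value at [a] itself,
    where Taylor's formula is centred, follows by continuity from the left. *)
Lemma derive_seq_eq0 F (a : R) :
  (forall k (t : R), is_derive t 1 (F k) (F k.+1 t)) ->
  (forall t, t < a -> F 0%N t = 0) -> forall k t, t <= a -> F k t = 0.
Proof.
move=> Fd F0.
have lt0 k t : t < a -> F k t = 0.
  elim: k t => [//|k IH] t ta.
  rewrite -(@derive_val _ _ _ _ _ _ _ (Fd k t)).
  rewrite (@near_eq_derive _ _ _ _ (cst 0)) ?derive_cst //.
  near=> s; apply: IH; near: s.
  exact: lt_nbhsl.
move=> k t; rewrite le_eqVlt => /predU1P[->|]; last exact: lt0.
have /cvg_at_left_filter h : F k s @[s --> a] --> F k a.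
  exact: is_derive_continuous (Fd k a).
rewrite -(cvg_lim _ h) //; apply: lim_near_cst => //.
by near=> s; apply: lt0; near: s; exact: nbhs_left_lt.
Unshelve. all: by end_near. Qed.

(** The radius [r] is the same at every point of [[0, T]], so finitely many extensions by [r / 2]
    reach [T]. The bounds are asked at infinitely many orders only, because M and N control
    derivatives of even order alone. *)
Lemma eq0_of_factorial_growth F (T r K : R) : 0 < r ->
  (forall k (t : R), is_derive t 1 (F k) (F k.+1 t)) ->
  (forall t, t < 0 -> F 0%N t = 0) ->
  (forall N, exists2 m, (N <= m)%N &
     forall t, 0 <= t <= T -> `|F m t| <= K * m`!%:R / r ^+ m) ->
  forall t, t <= T -> F 0%N t = 0.
Proof.
move=> r0 Fd F0 Fle.
suff H j t : t <= T -> t < j%:R * (r / 2) -> F 0%N t = 0.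
  move=> t tT; apply: (H (Num.truncn (`|t| / (r / 2))).+1 t tT).
  rewrite (le_lt_trans (ler_norm t)) // -ltr_pdivrMr ?divr_gt0 //.
  exact: truncnS_gt.
elim: j t => [t _|j IH t tT tj]; first by rewrite mul0r; exact: F0.
set a := j%:R * (r / 2).
have a0 : 0 <= a by rewrite mulr_ge0 // divr_ge0 // ltW.
have [ta|at_] := ltP t a; first exact: IH tT ta.
have F0a s : s < a -> F 0%N s = 0.
  by move=> sa; apply: (IH _ _ sa); rewrite (le_trans (ltW sa)) // (le_trans at_).
have Fa k : F k a = 0 by exact: (derive_seq_eq0 Fd F0a).
have ta : t - a <= r / 2.
  move: tj; rewrite -natr1 mulrDl mul1r -/a => tj; lra.
(* Since [t - a <= r / 2], the Taylor bound is at most [K * m! / r ^ m * (r / 2) ^ m / m! = K / 2 ^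
   m]. *)
have key N : exists2 m, (N <= m)%N & `|F 0%N t| <= K / 2 ^+ m.
  have [m Nm Fm] := Fle N; exists m => //.
  have Fm' s : a <= s <= T -> `|F m s| <= K * m`!%:R / r ^+ m.
    by move=> /andP[as_ sT]; apply: Fm; rewrite sT (le_trans a0).
  have := taylor_bound Fd Fa Fm' (t := t); rewrite at_ tT => /(_ isT) h.
  have K0 : 0 <= K * m`!%:R / r ^+ m by apply: le_trans (Fm' t _); rewrite ?at_.
  rewrite (le_trans h) // -mulrA.
  apply: (@le_trans _ _ (K * m`!%:R / r ^+ m * ((r / 2) ^+ m / m`!%:R))).
    by rewrite ler_wpM2l // ler_wpM2r ?invr_ge0 // lerXn2r ?nnegrE ?subr_ge0 //
      divr_ge0 // ltW.
  rewrite expr_div_n le_eqVlt; apply/orP; left; apply/eqP.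
  field; rewrite ?expf_neq0 ?gt_eqF //=; by rewrite ?expf_neq0 ?pnatr_eq0 -?lt0n
    ?fact_gt0 ?gt_eqF.
(* If [F 0 t] were nonzero, an order [m > K / |F 0 t|] would give [2 ^ m > K / |F 0 t|], against
   [key]. *)
apply/eqP; rewrite -normr_le0 leNgt; apply/negP => Ft0.
have [m Nm] := key (Num.truncn (K / `|F 0%N t|)).+1.
apply/negP; rewrite -ltNge ltr_pdivrMr ?exprn_gt0 // -ltr_pdivrMl // mulrC.
rewrite (lt_le_trans (truncnS_gt _)) //.
rewrite -natrX ler_nat (leq_trans Nm) //; exact/ltnW/ltn_expl.
Qed.

End taylor.

(** * The classes M and N *)

Section sobolev_classes.
Context {R : realType}.
Local Notation mu := (@lebesgue_measure R).
Implicit Types (A B f g h x : R -> R) (F D : nat -> R -> R).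

Lemma sqnorm2E f : sqnorm2 f = (\int[mu]_t (f t ^+ 2)%:E)%E.
Proof.
rewrite /sqnorm2 [X in X = _](_ : _ = ('N[mu]_2%:E[EFin \o f] `^ 2)%E).
  rewrite poweR_Lnorm //; apply: eq_integral => t _ /=.
  by rewrite powR_mulrn // real_normK // num_real.
have := Lnorm_ge0 mu 2%:E (EFin \o f); case: ('N[mu]_2%:E[_])%E => [r r0|_|//].
  by rewrite poweR_EFin powR_mulrn.
by rewrite poweRyr // ?expe2 ?mulyy.
Qed.

Lemma continuous_integrable_itv f (a b : R) : continuous f ->
  mu.-integrable `[a, b] (EFin \o f).
Proof.
move=> cf; apply: continuous_compact_integrable; first exact: segment_compact.
apply: continuous_subspaceT => s; exact: cf.
Qed.

(** [|f t|] is at most the integral of [|df|] over [[0, t]], and [u <= (1 + u ^ 2) / 2] stands in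
    for the Cauchy-Schwarz inequality, which keeps the bound linear in [B]. *)
Lemma le_norm_sqnorm2 f (df : R -> R) (t B : R) :
  (forall s : R, is_derive s 1 f (df s)) -> continuous df -> f 0 = 0 ->
  (sqnorm2 df <= B%:E)%E -> 0 <= t -> `|f t| <= (t + B) / 2.
Proof.
move=> fd cdf f0 dfB; rewrite le_eqVlt => /predU1P[<-|t0].
  rewrite f0 normr0 add0r divr_ge0 // -lee_fin; apply: le_trans dfB.
  by rewrite sqnorm2E integral_ge0 // => s _; rewrite lee_fin sqr_ge0.
have -> : f t = \int[mu]_(s in `[0, t]) df s.
  rewrite /Rintegral (@continuous_FTC2 _ df f) // ?f0 ?sube0 //.
  - exact: continuous_subspaceT.
  - split => [s _| |].
    + by case: (fd s).
    + by apply: cvg_at_right_filter; exact: is_derive_continuous (fd 0).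
    + by apply: cvg_at_left_filter; exact: is_derive_continuous (fd t).
  - by move=> s _; rewrite derive1E; case: (fd s).
have csq : continuous (fun s => df s ^+ 2).
  by move=> s; apply: (@continuousM _ _ df df); exact: cdf.
have cnm : continuous (fun s => `|df s|).
  by move=> s; apply: continuous_comp; [exact: cdf|exact: norm_continuous].
rewrite (le_trans (le_normr_Rintegral _ _)) //.
  exact: continuous_integrable_itv.
apply: (@le_trans _ _ (\int[mu]_(s in `[0, t]) (2^-1 * (1 + df s ^+ 2)))).
  apply: le_Rintegral => //.
  - exact: continuous_integrable_itv.
  - apply: continuous_integrable_itv => s.
    apply: cvgM; first exact: cvg_cst.
    apply: cvgD; [exact: cvg_cst|exact: csq].
  - move=> s _; have := sqr_ge0 (`|df s| - 1).
    rewrite -(real_normK (num_real (df s))); set u := `|df s|; nra.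
have i1 : mu.-integrable `[0, t] (EFin \o cst (1 : R)).
  by apply: continuous_integrable_itv; exact: cst_continuous.
have i2 : mu.-integrable `[0, t] (EFin \o (fun s => df s ^+ 2)).
  exact: continuous_integrable_itv.
rewrite RintegralZl //; last first.
  by apply: continuous_integrable_itv => s; apply: cvgD; [exact: cvg_cst|exact: csq].
rewrite RintegralD // mulrC ler_wpM2r // lerD //.
  by rewrite Rintegral_cst //= mul1r lebesgue_measure_itv /= lte_fin t0 oppr0 addr0.
rewrite -lee_fin fineK; last exact: integrable_fin_num.
apply: le_trans dfB; rewrite sqnorm2E.
apply: ge0_subset_integral => //.
- by apply/measurable_EFinP; exact: continuous_measurable_fun.
- by move=> s _; rewrite lee_fin sqr_ge0.
Qed.

Lemma smooth_is_derive f : smooth f ->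
  forall k (t : R), is_derive t 1 f^`(k)%classic (f^`(k.+1)%classic t).
Proof.
move=> sf k t; rewrite derive1nS derive1E; exact/derivableP/sf.
Qed.

(** Common core of M and N: the squared norm at the even order [k.+2] bounds the derivative of odd
    order [k.+1] pointwise, so every odd order has factorial growth. *)
Lemma smooth_eq0 f : smooth f -> (forall t, t < 0 -> f t = 0) ->
  (exists2 r : R, 0 < r & exists2 K, 0 <= K & forall k : nat, ~~ odd k ->
     (sqnorm2 f^`(k.+2)%classic <= (K * k.+1`!%:R / r ^+ k.+1)%:E)%E) ->
  forall t, f t = 0.
Proof.
move=> sf f0 [r r0 [K K0 Kf]] t.
have Fd := smooth_is_derive sf.
have Fc k : continuous (f^`(k)%classic) by move=> s; exact: is_derive_continuous (Fd k s).
have F0 k : f^`(k)%classic 0 = 0 by exact: (derive_seq_eq0 Fd f0).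
(* The radius is capped at 1 so that [s <= |t|] is itself at most [|t| * m! / q ^ m], with [q] the
   capped radius; this absorbs the linear term of the pointwise bound. *)
apply: (@eq0_of_factorial_growth R (fun k => f^`(k)%classic) `|t| (Num.min r 1)
  (`|t| + K)) => //.
- by rewrite lt_min r0 ltr01.
- move=> N; exists N.*2.+1; first by rewrite -addnn ltnW // ltnS leq_addr.
  move=> s /andP[s0 st].
  have := Kf N.*2; rewrite odd_double => /(_ isT) h.
  rewrite (le_trans (le_norm_sqnorm2 (Fd _) (Fc _) (F0 _) h s0)) //.
  set m := N.*2.+1; set q := Num.min r 1.
  have q0 : 0 < q by rewrite lt_min r0 ltr01.
  have h1 : s <= `|t| * m`!%:R / q ^+ m.
    rewrite (le_trans st) // -mulrA ler_peMr // ler_pdivlMr ?exprn_gt0 // mul1r.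
    rewrite (@le_trans _ _ 1) //; last by rewrite ler1n fact_gt0.
    by rewrite exprn_ile1 // ?ge_min ?lexx ?orbT // ltW.
  have h2 : K * m`!%:R / r ^+ m <= K * m`!%:R / q ^+ m.
    rewrite ler_wpM2l ?mulr_ge0 // lef_pV2 ?posrE ?exprn_gt0 //.
    by rewrite lerXn2r ?nnegrE ?(ltW r0) ?(ltW q0) // /q ge_min lexx.
  rewrite mulrDl mulrDl.
  have h3 : 0 <= K * m`!%:R / r ^+ m by rewrite mulr_ge0 ?mulr_ge0 ?invr_ge0
    ?exprn_ge0 // ltW.
  lra.
- exact: ler_norm.
Qed.

Lemma classM_eq0 (f : R -> R) : classM f -> (forall t, t < 0 -> f t = 0) ->
  forall t, f t = 0.
Proof.
move=> [C /= C0 [sf [M M0 fM]]] f0; apply: smooth_eq0 => //.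
exists C^-1; rewrite ?invr_gt0 //; exists (C * M); first by rewrite mulr_ge0 // ltW.
move=> k ok; rewrite (le_trans (fM k.+2 _)) //= ?negbK // lee_fin.
have -> : C * M * k.+1`!%:R / C^-1 ^+ k.+1 = C ^+ k.+2 * M * k.+1`!%:R.
  by rewrite exprVn invrK (exprS C k.+1); ring.
by rewrite ler_peMr ?ler1n ?fact_gt0 // mulr_ge0 ?exprn_ge0 // ltW.
Qed.

Lemma classN_eq0 (f : R -> R) : classN f -> (forall t, t < 0 -> f t = 0) ->
  forall t, f t = 0.
Proof.
move=> [C /= C0 [sf [M M0 fM]]] f0; apply: smooth_eq0 => //.
(* The class bound is used at the odd order [k.+1], discarding the norm of order [k]; clearing the
   factor 1/2 makes the constant [2 * M]. *)
exists C; rewrite //; exists (2 * M); first by rewrite mulr_ge0 // ltW.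
move=> k ok; have /= := fM k.+1 ok.
rewrite lee_pdivrMl // => h.
apply: le_trans (le_trans _ h) _.
  by rewrite leeDr // sqnorm2E integral_ge0 // => s _; rewrite lee_fin sqr_ge0.
by rewrite -EFinM lee_fin le_eqVlt; apply/orP; left; apply/eqP; rewrite -!mulrA;
  congr (_ * _); rewrite mulrA mulrC.
Qed.

End sobolev_classes.

(** * Real analyticity of the inverse Fourier integral *)

Section inverse_fourier.
Context {R : realType}.
Local Notation mu := (@lebesgue_measure R).
Implicit Types (A B f g h x : R -> R) (F D : nat -> R -> R).

(** [2 pi] times the real part of the inverse Fourier transform of [A + i B]. *)
Definition inv_fourier A B (s : R) : R :=
  \int[mu]_w (A w * cos (w * s) - B w * sin (w * s)).

Lemma is_derive_cosM (w s : R) : is_derive s 1 (fun s => cos (w * s))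
  (- (w * sin (w * s))).
Proof.
have h : is_derive s 1 ( *%R w) w by apply: is_derive_eq; rewrite /GRing.scale /= ; ring.
have := is_derive1_comp (is_derive_cos (w * s)) h; rewrite mulNr mulrC; exact.
Qed.

Lemma is_derive_sinM (w s : R) : is_derive s 1 (fun s => sin (w * s)) (w * cos (w * s)).
Proof.
have h : is_derive s 1 ( *%R w) w by apply: is_derive_eq; rewrite /GRing.scale /= ; ring.
have := is_derive1_comp (is_derive_sin (w * s)) h; rewrite mulrC; exact.
Qed.

Lemma norm_trig_comb_le (a b s : R) : `|a * cos s - b * sin s| <= `|a| + `|b|.
Proof.
rewrite (le_trans (ler_normB _ _)) // lerD // normrM ler_piMr //.
- by rewrite ler_norml cos_geN1 cos_le1.
- by rewrite ler_norml sin_geN1 sin_le1.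
Qed.

Lemma measurable_cosM (s : R) : measurable_fun [set: R] (fun w => cos (w * s)).
Proof.
apply: measurableT_comp; last exact: measurable_funM.
by apply: continuous_measurable_fun; exact: continuous_cos.
Qed.

Lemma measurable_sinM (s : R) : measurable_fun [set: R] (fun w => sin (w * s)).
Proof.
apply: measurableT_comp; last exact: measurable_funM.
by apply: continuous_measurable_fun; exact: continuous_sin.
Qed.

Lemma measurable_trig_comb A B s : measurable_fun setT A -> measurable_fun setT B ->
  measurable_fun setT (fun w => A w * cos (w * s) - B w * sin (w * s)).
Proof.
move=> mA mB; apply: measurable_funB; apply: measurable_funM => //.
- exact: measurable_cosM.
- exact: measurable_sinM.
Qed.

Lemma le_integrable_EFin f g : measurable_fun setT f -> (forall w, `|f w| <= g w) ->
  mu.-integrable setT (EFin \o g) -> mu.-integrable setT (EFin \o f).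
Proof.
move=> mf fg; apply: le_integrable => //; first exact/measurable_EFinP.
by move=> w _ /=; rewrite lee_fin (le_trans (fg w)) // ler_norm.
Qed.

Lemma integrable_trig_comb A B s : measurable_fun setT A -> measurable_fun setT B ->
  mu.-integrable setT (EFin \o (fun w => `|A w| + `|B w|)) ->
  mu.-integrable setT (EFin \o (fun w => A w * cos (w * s) - B w * sin (w * s))).
Proof.
move=> mA mB; apply: le_integrable_EFin; first exact: measurable_trig_comb.
by move=> w; exact: norm_trig_comb_le.
Qed.

(** Differentiating the integrand in [s] keeps its shape, with [(A, B)] replaced by [(- w B, w A)],
    so the rule can be iterated. The majorant [|w| * (|A w| + |B w|)] does not depend on [s], which
    licenses differentiation under the integral. *)
Lemma is_derive_inv_fourier A B (s : R) :
  measurable_fun setT A -> measurable_fun setT B ->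
  mu.-integrable setT (EFin \o (fun w => `|A w| + `|B w|)) ->
  mu.-integrable setT (EFin \o (fun w => `|w| * (`|A w| + `|B w|))) ->
  is_derive s 1 (inv_fourier A B)
    (inv_fourier (fun w => - (w * B w)) (fun w => w * A w) s).
Proof.
move=> mA mB iAB iwAB.
pose f (s w : R) := A w * cos (w * s) - B w * sin (w * s).
have fd w (u : R) : is_derive u 1 (f^~ w)
  (- (w * B w) * cos (w * u) - w * A w * sin (w * u)).
  rewrite /f.
  have := is_derive_cosM w u; have := is_derive_sinM w u => ? ?.
  apply: is_derive_eq; rewrite /GRing.scale /=; ring.
have d1E w u : partial1of2 f u w = - (w * B w) * cos (w * u) - w * A w * sin (w * u).
  by rewrite partial1of2E; case: (fd w u).
have I : `]s - 1, s + 1[%classic s by rewrite /= in_itv /= gtrBl ltrDl ltr01.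
have h1 (u : R) : `]s - 1, s + 1[%classic u -> mu.-integrable setT (EFin \o f u).
  by move=> _; exact: integrable_trig_comb.
have h2 (u w : R) : `]s - 1, s + 1[%classic u -> [set: R] w -> derivable (f ^~ w) u 1.
  by move=> _ _; case: (fd w u).
have h3 w : 0 <= `|w| * (`|A w| + `|B w|) by rewrite mulr_ge0 // addr_ge0.
have h4 (u w : R) : `]s - 1, s + 1[%classic u -> [set: R] w ->
  `|partial1of2 f u w| <= `|w| * (`|A w| + `|B w|).
  move=> _ _; rewrite d1E (le_trans (norm_trig_comb_le _ _ _)) //.
  by rewrite normrN !normrM mulrDr addrC.
apply: DeriveDef.
  exact: (@derivable_under_integral R _ _ mu f setT measurableT s _ _ I h1 h2 _ h3
    iwAB h4).
rewrite -derive1E (@differentiation_under_integral R _ _ mu f setT measurableT s _ _ I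
  h1 h2 _ h3 iwAB h4).
by apply: eq_Rintegral => w _; rewrite d1E.
Qed.

(** Iterates [X w |-> i w X w] on [X = A + i B], the Fourier side of [d/ds]. *)
Fixpoint spectral_deriv A B n : (R -> R) * (R -> R) :=
  if n is m.+1 then
    let p := spectral_deriv A B m in (fun w => - (w * p.2 w), fun w => w * p.1 w)
  else (A, B).

Lemma norm_spectral_deriv A B n w :
  `|(spectral_deriv A B n).1 w| + `|(spectral_deriv A B n).2 w| =
    `|w| ^+ n * (`|A w| + `|B w|).
Proof.
elim: n => [|n IH] /=; first by rewrite expr0 mul1r.
by rewrite normrN !normrM -mulrDr addrC IH exprS mulrA.
Qed.

Lemma measurable_spectral_deriv A B n :
  measurable_fun setT A -> measurable_fun setT B ->
  measurable_fun setT (spectral_deriv A B n).1 /\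
    measurable_fun setT (spectral_deriv A B n).2.
Proof.
move=> mA mB; elim: n => [//|n [m1 m2]] /=; split.
  by apply: measurableT_comp => //; exact: measurable_funM.
exact: measurable_funM.
Qed.

(** At [r * |w|] this reads [|w| ^ n <= n! / r ^ n * e ^ (r |w|)]: the exponential weight pays for
    [n] derivatives at factorial cost. *)
Lemma expr_fact_le_expR (n : nat) (x : R) : 0 <= x -> x ^+ n / n`!%:R <= expR x.
Proof.
move=> x0; case: n => [|n]; first by rewrite expr0 fact0 divr1 -expR0 ler_expR.
by rewrite (le_trans _ (expR_ge1Dxn n x0)) // lerDr.
Qed.

(** The [n]-th derivative is the inverse integral of [spectral_deriv A B n], bounded on the whole
    line by [n! / r ^ n] times the weighted integral: the growth that [eq0_of_factorial_growth] asks
    for. *)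
Lemma inv_fourier_eq0 A B (r : R) : 0 < r ->
  measurable_fun setT A -> measurable_fun setT B ->
  mu.-integrable setT (EFin \o (fun w => expR (r * `|w|) * (`|A w| + `|B w|))) ->
  (forall s, s < 0 -> inv_fourier A B s = 0) -> forall s, inv_fourier A B s = 0.
Proof.
move=> r0 mA mB iAB Y0 s.
pose D n := spectral_deriv A B n.
pose g w := expR (r * `|w|) * (`|A w| + `|B w|).
have mD n : measurable_fun setT (D n).1 /\ measurable_fun setT (D n).2
  by exact: measurable_spectral_deriv.
have mnD n : measurable_fun setT (fun w => `|(D n).1 w| + `|(D n).2 w|).
  by have [m1 m2] := mD n; apply: measurable_funD; exact: measurableT_comp.
have le n w : `|(D n).1 w| + `|(D n).2 w| <= n`!%:R / r ^+ n * g w.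
  rewrite norm_spectral_deriv /g mulrA ler_wpM2r ?addr_ge0 //.
  rewrite mulrAC ler_pdivlMr ?exprn_gt0 // -exprMn [`|w| * r]mulrC [_%:R * _]mulrC.
  by rewrite -ler_pdivrMr ?ltr0n ?fact_gt0 // expr_fact_le_expR // mulr_ge0 // ltW.
have ig n : mu.-integrable setT (EFin \o (fun w => n`!%:R / r ^+ n * g w)).
  have := integrableZl measurableT (n`!%:R / r ^+ n) iAB.
  by apply: eq_integrable.
have iD n : mu.-integrable setT (EFin \o (fun w => `|(D n).1 w| + `|(D n).2 w|)).
  apply: le_integrable_EFin (ig n) => // w.
  by rewrite ger0_norm ?addr_ge0 //; exact: le.
apply: (@eq0_of_factorial_growth R (fun n => inv_fourier (D n).1 (D n).2) s r
  (\int[mu]_w g w)) => //.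
- move=> k t; have [m1 m2] := mD k.
  apply: is_derive_inv_fourier => //.
  apply: eq_integrable (iD k.+1) => // w _ /=.
  by rewrite normrN !normrM -mulrDr addrC.
- move=> N; exists N => // t _; have [m1 m2] := mD N.
  have it := integrable_trig_comb t m1 m2 (iD N).
  rewrite (le_trans (le_normr_Rintegral _ it)) //.
  rewrite -mulrA mulrC -RintegralZl //.
  apply: le_Rintegral => //; first exact: integrable_norm.
  by move=> w _; rewrite (le_trans (norm_trig_comb_le _ _ _)).
Qed.

End inverse_fourier.

(** * The Poisson kernel *)

Section poisson_kernel.
Context {R : realType}.
Local Notation mu := (@lebesgue_measure R).
Implicit Types (A B f g h x : R -> R) (F D : nat -> R -> R).

Definition poisson (e u : R) : R := 2 * e / (e ^+ 2 + u ^+ 2).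

Lemma is_derive_expRM (e w : R) : is_derive w 1 (fun w : R => expR (- (e * w)))
  (- (e * expR (- (e * w)))).
Proof.
have h : is_derive w 1 (fun w : R => - (e * w)) (- e) by apply: is_derive_eq;
  rewrite /GRing.scale /= ; ring.
have := @is_derive1_comp R expR (fun w : R => - (e * w)) w _ _ (is_derive_expR _) h.
by rewrite mulrN mulrC.
Qed.

(** Adding 1 to the cosine makes the integrand nonnegative, so that, after folding by evenness, the
    fundamental theorem on a half-line applies to nonnegative functions. The extra [2 / e] is the
    integral of the exponential alone. *)
Lemma integral_exp_1Dcos (e u : R) : 0 < e ->
  (\int[mu]_w (expR (- (e * `|w|)) * (1 + cos (w * u)))%:E = (poisson e u + 2 / e)%:E)%E.
Proof.
move=> e0.
have d0 : 0 < e ^+ 2 + u ^+ 2 by rewrite ltr_wpDr ?sqr_ge0 // exprn_gt0.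
pose f (w : R) := expR (- (e * `|w|)) * (1 + cos (w * u)).
pose f1 w := expR (- (e * w)) * (1 + cos (w * u)).
have cosD1_ge0 w : 0 <= 1 + cos (w * u) by rewrite -lerBlDl sub0r cos_geN1.
have f0 w : 0 <= f w by rewrite mulr_ge0 ?expR_ge0.
have ccos : continuous (fun w : R => 1 + cos (w * u)).
  move=> w; apply: cvgD; first exact: cvg_cst.
  apply: (@continuous_comp _ _ _ (fun w : R => w * u) cos); last exact: continuous_cos.
  exact: mulrr_continuous.
have cf : continuous f.
  move=> w; apply: cvgM; last exact: ccos.
  apply: (@continuous_comp _ _ _ (fun w : R => - (e * `|w|)) (@expR R));
    last exact: continuous_expR.
  apply: cvgN; apply: cvgM; first exact: cvg_cst.
  exact: norm_continuous.
rewrite (ge0_symfun_integralT f0 cf); last first.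
  by move=> w; rewrite /f /= normrN mulNr cosN.
rewrite -set_itvcy.
pose q w := (u * sin (w * u) - e * cos (w * u)) / (e ^+ 2 + u ^+ 2) - e^-1.
pose F w := expR (- (e * w)) * q w.
have Fd (w : R) : is_derive w 1 F (f1 w).
  have hs : is_derive w 1 (fun w : R => sin (w * u)) (u * cos (w * u)).
    by under eq_fun do rewrite mulrC; rewrite (mulrC w); exact: is_derive_sinM.
  have hc : is_derive w 1 (fun w : R => cos (w * u)) (- (u * sin (w * u))).
    by under eq_fun do rewrite mulrC; rewrite (mulrC w); exact: is_derive_cosM.
  have he := is_derive_expRM e w.
  rewrite /F /q /f1; apply: is_derive_eq; rewrite /GRing.scale /=.
  by field; rewrite !gt_eqF.
rewrite (@ge0_continuous_FTC2y _ f F 0 0); first last.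
- move=> w; rewrite in_itv /= andbT => w0; rewrite derive1E.
  by rewrite (@derive_val _ _ _ _ _ _ _ (Fd w)) /f /f1 gtr0_norm.
- by apply: cvg_at_right_filter; exact: is_derive_continuous (Fd 0).
- by move=> w _; case: (Fd w).
(* The primitive [F] tends to 0 at infinity: [q] is bounded by [c], and [w >= c / (d * e)] gives
   [c / d <= 1 + e * w <= expR (e * w)]. *)
- pose c := (`|u| + e) / (e ^+ 2 + u ^+ 2) + e^-1.
  have c0 : 0 < c by apply: ltr_wpDl; [apply: divr_ge0;
    [exact: addr_ge0 (ltW e0)|exact: ltW]|rewrite invr_gt0].
  have qc w : `|q w| <= c.
    rewrite /q /c (le_trans (ler_normB _ _)) // lerD //; last
      by rewrite gtr0_norm ?invr_gt0.
    rewrite normrM (@gtr0_norm _ (_^-1)) ?invr_gt0 // ler_wpM2r ?invr_ge0 ?(ltW d0) //.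
    rewrite (le_trans (ler_normB _ _)) // !normrM lerD //.
      by rewrite ler_piMr // ler_norml sin_geN1 sin_le1.
    by rewrite (gtr0_norm e0) ler_piMr ?(ltW e0) // ler_norml cos_geN1 cos_le1.
  apply/cvgrPdist_le => d dp.
  near=> w.
  have w0 : 0 < w by near: w; exact: nbhs_pinfty_gt.
  have wl : c / d / e <= w by near: w; apply: nbhs_pinfty_ge; exact: num_real.
  rewrite sub0r normrN /F normrM gtr0_norm ?expR_gt0 //
    expRN mulrC ler_pdivrMr ?expR_gt0 //.
  rewrite (le_trans (qc w)) // -ler_pdivrMl // mulrC.
  apply: (@le_trans _ _ (1 + e * w)); last exact: expR_ge1Dx.
  move: wl; rewrite ler_pdivrMr // [w * e]mulrC => wl.
  by rewrite (le_trans wl) // lerDr.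
- exact: continuous_subspaceT.
- by move=> w _; exact: f0.
rewrite sub0e -EFinN -EFinM /F /q mulr0 oppr0 expR0 mul0r sin0 cos0 /poisson.
congr EFin; field; by rewrite !gt_eqF.
Unshelve. all: by end_near. Qed.

Lemma integrable_exp (e : R) : 0 < e ->
  mu.-integrable setT (EFin \o (fun w : R => expR (- (e * `|w|)))).
Proof.
move=> e0.
have m : measurable_fun [set: R] (fun w : R => expR (- (e * `|w|))).
  apply: measurableT_comp => //; apply: measurableT_comp => //;
    apply: measurable_funM => //.
have i : mu.-integrable setT (EFin \o (fun w : R => 2 * expR (- (e * `|w|)))).
  apply/integrableP; split; first by apply/measurable_EFinP; apply: measurable_funM.
  have h := integral_exp_1Dcos 0 e0.
  apply: le_lt_trans (ltry (poisson e 0 + 2 / e)); rewrite -h le_eqVlt.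
  apply/orP; left; apply/eqP; apply: eq_integral => w _ /=.
  by rewrite mulr0 cos0 ger0_norm ?mulr_ge0 ?expR_ge0 // mulrC.
apply: le_integrable_EFin i => // w.
by rewrite ger0_norm ?expR_ge0 // ler_peMl ?expR_ge0 // ler1n.
Qed.

(** The case [u = 0] of [integral_exp_1Dcos] says that twice the integral of the exponential is
    [4 / e]; subtracting that integral removes the summand 1. *)
Lemma Rintegral_exp_cos (e u : R) : 0 < e ->
  \int[mu]_w (expR (- (e * `|w|)) * cos (w * u)) = poisson e u.
Proof.
move=> e0.
have i1 := integrable_exp e0.
have i2 v : mu.-integrable setT
  (EFin \o (fun w : R => expR (- (e * `|w|)) * cos (w * v))).
  apply: le_integrable_EFin i1.
    apply: measurable_funM; last exact: measurable_cosM.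
    by apply: measurableT_comp => //; apply: measurableT_comp => //;
      apply: measurable_funM.
  move=> w; rewrite normrM (gtr0_norm (expR_gt0 _)) ler_piMr ?expR_ge0 //.
  by rewrite ler_norml cos_geN1 cos_le1.
have h v : \int[mu]_w expR (- (e * `|w|)) +
    \int[mu]_w (expR (- (e * `|w|)) * cos (w * v)) = poisson e v + 2 / e.
  rewrite -RintegralD //.
  under eq_Rintegral do rewrite -[X in X + _]mulr1 -mulrDr.
  by rewrite /Rintegral integral_exp_1Dcos.
have h0 : \int[mu]_w expR (- (e * `|w|)) = 2 / e.
  have := h 0.
  under [X in _ + X = _]eq_Rintegral do rewrite mulr0 cos0 mulr1.
  have -> : poisson e 0 = 2 / e by rewrite /poisson expr0n /= addr0; field;
    rewrite gt_eqF.
  lra.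
by have := h u; rewrite h0 addrC => /addIr.
Qed.

(** A product majorant makes [f] integrable on the plane: integrating in [t] leaves [|g s|] times
    the integral of [|h|]. Integrability of the inner integral is kept in the conclusion because its
    measurability is reused below. *)
Lemma Rintegral_fubini (f : measurableTypeR R * measurableTypeR R -> R) (g h : R -> R) :
  measurable_fun setT f ->
  mu.-integrable setT (EFin \o g) -> mu.-integrable setT (EFin \o h) ->
  (forall s t, `|f (s, t)| <= g s * h t) ->
  mu.-integrable setT (EFin \o (fun s => \int[mu]_t f (s, t))) /\
      \int[mu]_s (\int[mu]_t f (s, t)) = \int[mu]_t (\int[mu]_s f (s, t)).
Proof.
move=> mf ig ih fgh.
have mfE : measurable_fun setT (EFin \o f) by exact/measurable_EFinP.
have f1 s : mu.-integrable setT (fun t => (f (s, t))%:E).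
  apply: (@le_integrable_EFin R (fun t => f (s, t)) (fun t => g s * h t)) => //.
    exact: measurableT_comp.
  by have := integrableZl measurableT (g s) ih; apply: eq_integrable.
have f2 t : mu.-integrable setT (fun s => (f (s, t))%:E).
  apply: (@le_integrable_EFin R (fun s => f (s, t)) (fun s => g s * h t)) => //.
    exact: measurableT_comp.
  by have := integrableZr measurableT (h t) ig; apply: eq_integrable.
have ifp : (mu \x mu)%E.-integrable setT (EFin \o f).
  apply/integrable12ltyP => //.
  pose c := \int[mu]_t `|h t|.
  have igc : mu.-integrable setT (EFin \o (fun s => `|g s| * c)).
    by have := integrableZr measurableT c (integrable_norm ig); apply: eq_integrable.
  apply: (@le_lt_trans _ _ (\int[mu]_s (`|g s| * c)%:E)%E); last first.
    by have := integrable_lty measurableT igc.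
  apply: ge0_le_integral => //.
  - by move=> s _; exact: integral_ge0.
  - apply: (measurable_fun_fubini_tonelli_F (fun st => `|(f st)%:E|%E)) => //.
    exact: measurableT_comp.
  - by have /integrableP[] := igc.
  - move=> s _ /=.
    have := ih => /integrable_norm ih'.
    have ih2 : mu.-integrable setT (EFin \o (fun t => `|g s| * `|h t|)).
      by have := integrableZl measurableT `|g s| ih'; apply: eq_integrable.
    rewrite /c -RintegralZl // /Rintegral fineK; last exact: integrable_fin_num.
    apply: ge0_le_integral => //.
    + apply/measurable_EFinP; apply: measurableT_comp => //.
      by apply/measurable_EFinP; exact: (measurable_int mu (f1 s)).
    + by have /integrableP[] := ih2.
    + move=> t _; rewrite lee_fin (le_trans (fgh s t)) // -normrM; exact: ler_norm.
have E1 s : (\int[mu]_t f (s, t))%:E = (\int[mu]_t (EFin \o f) (s, t))%E.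
  by rewrite /Rintegral fineK //; exact: integrable_fin_num.
have E2 t : (\int[mu]_s f (s, t))%:E = (\int[mu]_s (EFin \o f) (s, t))%E.
  by rewrite /Rintegral fineK //; exact: integrable_fin_num.
split.
- have := integrable_fubini_F ifp; apply: eq_integrable => // s _ /=.
  by rewrite E1.
- rewrite {1}/Rintegral [RHS]/Rintegral.
  under eq_integral do rewrite E1.
  under [in RHS]eq_integral do rewrite E2.
  by rewrite (Fubini ifp).
Qed.

End poisson_kernel.

(** * Dominated convergence and pointwise bounds for the Poisson kernel *)

Section poisson_estimates.
Context {R : realType}.
Local Notation mu := (@lebesgue_measure R).
Implicit Types (A B f g h x : R -> R) (F D : nat -> R -> R).

Lemma Rdominated_cvg F f g :
  (forall n, measurable_fun setT (F n)) -> measurable_fun setT f ->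
  mu.-integrable setT (EFin \o g) ->
  {ae mu, forall w, F n w @[n --> \oo] --> f w} -> (forall n w, `|F n w| <= g w) ->
  \int[mu]_w F n w @[n --> \oo] --> \int[mu]_w f w.
Proof.
move=> mF mf ig Ff Fg.
have h1 n : measurable_fun setT (fun w => (F n w)%:E) by exact/measurable_EFinP.
have h2 : measurable_fun setT (EFin \o f) by exact/measurable_EFinP.
have h3 : {ae mu, forall w, [set: R] w -> (F n w)%:E @[n --> \oo] --> (f w)%:E}.
  move: Ff; apply: filterS; first exact: (ae_filter_ringOfSetsType mu).
  move=> w Fw _; apply: cvg_EFin => //; exact: nearW.
have h4 : {ae mu, forall w n, [set: R] w -> (`|(F n w)%:E| <= (g w)%:E)%E}.
  by apply: aeW => w n _; rewrite lee_fin.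
have [fi _ h] := @dominated_convergence _ _ _ mu setT measurableT
  (fun n w => (F n w)%:E) (EFin \o f) (EFin \o g) h1 h2 h3 ig h4.
by apply: fine_cvg; rewrite fineK //; exact: integrable_fin_num.
Qed.

Lemma Rintegral_indic (D : set R) g :
  \int[mu]_s (\1_D s * g s) = \int[mu]_(s in D) g s.
Proof.
rewrite [RHS]Rintegral_mkcond; apply: eq_Rintegral => s _.
by rewrite patchE indicE; case: ifP; rewrite ?mul1r ?mul0r.
Qed.

Lemma measurable_exp_abs (e : R) : measurable_fun [set: R]
  (fun w : R => expR (- (e * `|w|))).
Proof.
by apply: measurableT_comp => //; apply: measurableT_comp => //; apply: measurable_funM.
Qed.

Lemma norm_damped_le A B (e s w : R) : 0 <= e ->
  `|expR (- (e * `|w|)) * (A w * cos (w * s) - B w * sin (w * s))|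
    <= `|A w| + `|B w|.
Proof.
move=> e0; rewrite normrM -[leRHS]mul1r ler_pM //; last exact: norm_trig_comb_le.
by rewrite ger0_norm ?expR_ge0 // -expR0 ler_expR oppr_le0 mulr_ge0.
Qed.

Lemma norm_damped_inv_fourier_le A B (e s : R) : 0 <= e ->
  measurable_fun setT A -> measurable_fun setT B ->
  mu.-integrable setT (EFin \o (fun w => `|A w| + `|B w|)) ->
  `|\int[mu]_w (expR (- (e * `|w|)) * (A w * cos (w * s) - B w * sin (w * s)))|
    <= \int[mu]_w (`|A w| + `|B w|).
Proof.
move=> e0 mA mB iAB.
have i : mu.-integrable setT (EFin \o
  (fun w => expR (- (e * `|w|)) * (A w * cos (w * s) - B w * sin (w * s)))).
  apply: le_integrable_EFin iAB => [|w]; last exact: norm_damped_le.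
  by apply: measurable_funM; [exact: measurable_exp_abs|exact: measurable_trig_comb].
rewrite (le_trans (le_normr_Rintegral _ i)) //; apply: le_Rintegral => //.
  exact: integrable_norm.
by move=> w _; exact: norm_damped_le.
Qed.

(** Abel summation along [e = 1 / (n + 1)]: the damping factor tends to 1 and stays at most 1, so
    [|A| + |B|] dominates. *)
Lemma cvg_damped_inv_fourier A B (s : R) :
  measurable_fun setT A -> measurable_fun setT B ->
  mu.-integrable setT (EFin \o (fun w => `|A w| + `|B w|)) ->
  \int[mu]_w (expR (- (n.+1%:R^-1 * `|w|)) * (A w * cos (w * s) - B w * sin (w * s)))
     @[n --> \oo] --> inv_fourier A B s.
Proof.
move=> mA mB iAB; apply: Rdominated_cvg iAB _ _.
- by move=> n; apply: measurable_funM;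
    [exact: measurable_exp_abs|exact: measurable_trig_comb].
- exact: measurable_trig_comb.
- apply: aeW => w; rewrite -[X in _ --> X]mul1r; apply: cvgM; last exact: cvg_cst.
  rewrite [X in _ --> X](_ : _ = expR (- (0 * `|w|))); last by rewrite mul0r oppr0 expR0.
  apply: continuous_cvg; first exact: continuous_expR.
  by apply: cvgN; apply: cvgM; [exact: cvg_harmonic|exact: cvg_cst].
- by move=> n w; apply: norm_damped_le; rewrite invr_ge0.
Qed.

Lemma measurable_poisson (e : R) : 0 < e -> measurable_fun [set: R] (poisson e).
Proof.
move=> e0; apply: continuous_measurable_fun => u.
apply: cvgM; first exact: cvg_cst.
apply: cvgV; first by rewrite gt_eqF // ltr_wpDr ?sqr_ge0 // exprn_gt0.
by apply: cvgD; [exact: cvg_cst|exact: exprn_continuous].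
Qed.

Lemma poisson_ge0 (e u : R) : 0 <= e -> 0 <= poisson e u.
Proof. by move=> e0; rewrite divr_ge0 ?mulr_ge0 // addr_ge0 ?sqr_ge0. Qed.

Lemma poisson_le_dist (e u d : R) : 0 <= e -> 0 < d -> d <= u ^+ 2 ->
  poisson e u <= 2 * e / d.
Proof.
move=> e0 d0 du; rewrite ler_wpM2l ?mulr_ge0 // lef_pV2 ?posrE //.
  by rewrite (le_trans du) // lerDr sqr_ge0.
by rewrite ltr_wpDl ?sqr_ge0 // (lt_le_trans d0).
Qed.

(** From [t ^ 2 <= 2 (t - s) ^ 2 + 2 s ^ 2] one gets [1 + t ^ 2 <= (2 + (1 + 2 b ^ 2) / e ^ 2) * (e
    ^ 2 + (t - s) ^ 2)]. For fixed [e] the kernel thus decays like [1 / (1 + t ^ 2)], uniformly in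
    [|s| <= b]. *)
Lemma poisson_le_weight (e t s b : R) : 0 < e -> `|s| <= b ->
  poisson e (t - s) <= 2 * e * (2 + (1 + 2 * b ^+ 2) / e ^+ 2) / (1 + t ^+ 2).
Proof.
move=> e0 sb.
have t0 : 0 < 1 + t ^+ 2 by rewrite ltr_wpDr ?sqr_ge0.
have e2 : 0 < e ^+ 2 by rewrite exprn_gt0.
have d0 : 0 < e ^+ 2 + (t - s) ^+ 2 by rewrite ltr_wpDr ?sqr_ge0.
rewrite /poisson -!mulrA ler_wpM2l // ler_wpM2l ?(ltW e0) //.
rewrite ler_pdivlMr // mulrC ler_pdivrMr //.
have sb2 : s ^+ 2 <= b ^+ 2.
  by rewrite -real_normK ?num_real // lerXn2r ?nnegrE // (le_trans _ sb).
set c := (1 + 2 * b ^+ 2) / e ^+ 2.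
have ce : c * e ^+ 2 = 1 + 2 * b ^+ 2 by rewrite /c mulfVK // gt_eqF.
have c0 : 0 <= c by apply: divr_ge0; [have := sqr_ge0 b; lra|exact: ltW].
have h1 : 0 <= c * (t - s) ^+ 2 by rewrite mulr_ge0 ?sqr_ge0.
have h2 := sqr_ge0 (t - 2 * s).
rewrite mulrDl [c * _]mulrDr ce.
nra.
Qed.

Lemma continuous_poisson_sub (e t : R) : 0 < e ->
  continuous (fun s : R => poisson e (t - s)).
Proof.
move=> e0 s; apply: cvgM; first exact: cvg_cst.
apply: cvgV; first by rewrite gt_eqF // ltr_wpDr ?sqr_ge0 // exprn_gt0.
apply: cvgD; first exact: cvg_cst.
apply: (@continuous_comp _ _ _ (fun s : R => t - s) (fun u : R => u ^+ 2));
  last exact: exprn_continuous.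
by apply: cvgB; [exact: cvg_cst|exact: cvg_id].
Qed.

(** For almost every [t], this tends to [2 pi] inside [[0, b]] and to 0 outside as [e] tends to 0,
    so it acts as an approximate indicator. *)
Lemma Rintegral_poisson_itv (e t b : R) : 0 < e -> 0 < b ->
  \int[mu]_(s in `[0, b]) poisson e (t - s) = 2 * (atan (t / e) - atan ((t - b) / e)).
Proof.
move=> e0 b0.
pose F s := - 2 * atan ((t - s) / e).
have d0 s : 0 < e ^+ 2 + (t - s) ^+ 2 by rewrite ltr_wpDr ?sqr_ge0 // exprn_gt0.
have Fd (s : R) : is_derive s 1 F (poisson e (t - s)).
  have h : is_derive s 1 (fun s => (t - s) / e) (- e^-1).
    by apply: is_derive_eq; rewrite /GRing.scale /=; ring.
  have h2 := @is_derive1_comp R atan (fun s => (t - s) / e) s _ _ (is_derive1_atan _) h.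
  have -> : F = (fun s => (- 2) *: (atan \o (fun s => (t - s) / e)) s) by [].
  apply: is_derive_eq; rewrite /GRing.scale /= /poisson.
  have /gt_eqF/negbT d1 := d0 s.
  have d2 : 1 + ((t - s) / e) ^+ 2 != 0 by rewrite gt_eqF // ltr_wpDr ?sqr_ge0.
  have e1 : e != 0 by rewrite gt_eqF.
  have -> : 1 + ((t - s) / e) ^+ 2 = (e ^+ 2 + (t - s) ^+ 2) / e ^+ 2.
    by rewrite expr_div_n; field.
  by field; rewrite e1 d1.
have h1 : {within `[0, b], continuous (fun s => poisson e (t - s))}.
  exact/continuous_subspaceT/continuous_poisson_sub.
have h2 : derivable_oo_LRcontinuous F 0 b.
  split => [s _| |].
  - by case: (Fd s).
  - by apply: cvg_at_right_filter; exact: is_derive_continuous (Fd 0).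
  - by apply: cvg_at_left_filter; exact: is_derive_continuous (Fd b).
have h3 : {in `]0, b[, F^`()%classic =1 (fun s => poisson e (t - s))}.
  by move=> s _; rewrite derive1E; case: (Fd s).
rewrite /Rintegral (continuous_FTC2 b0 h1 h2 h3) /F subr0 -EFinB /=; ring.
Qed.

End poisson_estimates.

(** * The integrated Poisson kernel as [e] tends to 0 *)

Section poisson_estimates2.
Context {R : realType}.
Local Notation mu := (@lebesgue_measure R).
Implicit Types (A B f g h x : R -> R) (F D : nat -> R -> R).

(** Majorant independent of [e], for dominated convergence. Its constant adds two regimes: for
    [t < b + 1] the arctangents differ by at most [pi]; for [t >= b + 1] the distance from [t] to
    [[0, b]] is [t - b >= 1], so the kernel is at most [2 / (t - b) ^ 2]. *)
Lemma atan_diff_bound (e t b : R) : 0 < e -> e <= 1 -> 0 < b -> 0 < t ->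
  0 <= 2 * (atan (t / e) - atan ((t - b) / e))
    <= (2 * pi * (1 + (b + 1) ^+ 2) + 2 * b * (3 + 2 * b ^+ 2)) / (1 + t ^+ 2).
Proof.
move=> e0 e1 b0 t0.
have t2 : 0 < 1 + t ^+ 2 by rewrite ltr_wpDr ?sqr_ge0.
have pi0 : 0 < pi :> R := pi_gt0 R.
apply/andP; split.
  rewrite -Rintegral_poisson_itv //; apply: Rintegral_ge0 => s _.
  exact/poisson_ge0/ltW.
rewrite ler_pdivlMr //.
have [tb|tb] := ltP t (b + 1).
  have h : 2 * (atan (t / e) - atan ((t - b) / e)) <= 2 * pi.
    have := atan_ltpi2 (t / e); have := atan_gtNpi2 ((t - b) / e); lra.
  apply: (@le_trans _ _ (2 * pi * (1 + (b + 1) ^+ 2))).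
    apply: (@le_trans _ _ (2 * pi * (1 + t ^+ 2))); first by rewrite ler_wpM2r ?(ltW t2).
    by rewrite ler_wpM2l ?mulr_ge0 ?(ltW pi0) // lerD //
      lerXn2r ?nnegrE ?(ltW t0) ?(ltW tb) // addr_ge0 ?(ltW b0).
  by rewrite lerDl; apply: mulr_ge0; [lra|have := sqr_ge0 b; lra].
have d1 : 1 <= t - b by rewrite lerBrDl.
set d := (t - b) ^+ 2.
have dd : 1 <= d by rewrite exprn_ege1.
have d0 : 0 < d by rewrite (lt_le_trans _ dd).
apply: (@le_trans _ _ (2 / d * b * (1 + t ^+ 2))).
  rewrite ler_wpM2r ?(ltW t2) // -Rintegral_poisson_itv //.
  have -> : 2 / d * b = \int[mu]_(s in `[0, b]) (2 / d).
    by rewrite Rintegral_cst //= lebesgue_measure_itv /= lte_fin b0 oppr0 addr0.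
  apply: le_Rintegral => //.
  - exact/continuous_integrable_itv/continuous_poisson_sub.
  - by apply: continuous_integrable_itv; exact: cst_continuous.
  - move=> s; rewrite /= in_itv /= => /andP[s0 sb].
    apply: (le_trans (poisson_le_dist _ d0 _)); rewrite ?(ltW e0) //.
      by rewrite /d lerXn2r ?nnegrE; lra.
    by rewrite ler_wpM2r ?invr_ge0 ?(ltW d0) // ler_piMr.
(* Use [t ^ 2 <= 2 (t - b) ^ 2 + 2 b ^ 2], then [1 <= d] to multiply the constants by [d]. *)
have h : 1 + t ^+ 2 <= (3 + 2 * b ^+ 2) * d.
  have := sqr_ge0 (t - 2 * b); have := sqr_ge0 b; rewrite /d in dd *; nra.
apply: (@le_trans _ _ (2 / d * b * ((3 + 2 * b ^+ 2) * d))).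
  by rewrite ler_wpM2l // mulr_ge0 ?(ltW b0) // divr_ge0 // ltW.
rewrite [X in X <= _](_ : _ = 2 * b * (3 + 2 * b ^+ 2)); last by field; rewrite gt_eqF.
by rewrite lerDr mulr_ge0 ?mulr_ge0 ?(ltW pi0) // addr_ge0 ?sqr_ge0.
Qed.

Lemma cvg_atan_scale (u : R) : u != 0 ->
  atan (u / n.+1%:R^-1) @[n --> \oo] --> Num.sg u * (pi / 2).
Proof.
move=> u0.
have h (v : R) : 0 < v -> atan (v / n.+1%:R^-1) @[n --> \oo] --> pi / 2.
  move=> v0.
  apply: (@cvg_comp _ _ _ (fun n : nat => v / n.+1%:R^-1) atan _ _ _ _ (@cvgy_atan R)).
  apply/cvgryPge => a; near=> n.
  rewrite invrK mulrC -ler_pdivrMr //.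
  rewrite (@le_trans _ _ n%:R) // ?ler_nat //.
  near: n; exact: nbhs_infty_ger.
have [v0|v0|/eqP] := ltgtP u 0; last by rewrite (negbTE u0).
  rewrite ltr0_sg // mulN1r.
  have k : - atan (- u / n.+1%:R^-1) @[n --> \oo] --> - (pi / 2).
    by apply: cvgN; apply: h; rewrite oppr_gt0.
  apply: cvg_trans k; apply: near_eq_cvg; apply: nearW => n.
  by rewrite mulNr atanN opprK.
by rewrite gtr0_sg // mul1r; exact: h.
Unshelve. all: by end_near. Qed.

Lemma ae_neq (b : R) : {ae mu, forall t, t != b}.
Proof.
exists [set b]; split; [exact: measurable_set1|exact: lebesgue_measure_set1|].
by move=> t /= /negP; rewrite negbK => /eqP.
Qed.

End poisson_estimates2.

(** * Functions determined by their Poisson integrals *)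

Section poisson_representation.
Context {R : realType}.
Local Notation mu := (@lebesgue_measure R).
Implicit Types (A B f g h x : R -> R) (F D : nat -> R -> R).

(** Both sides are [2 pi] times the Poisson extension of [x] to the upper
half-plane at [(s, e)]; [A + i B] plays the part of the Fourier transform. *)
Definition poisson_formula x A B := forall e s : R, 0 < e ->
  \int[mu]_w (expR (- (e * `|w|)) * (A w * cos (w * s) - B w * sin (w * s))) =
  \int[mu]_t (x t * poisson e (t - s)).

(** The weight matches the decay of the Poisson kernel, and [weighted x] is integrable for [x] in L1
    as well as in L2, so one argument serves both readings of the Fourier transform. *)
Definition weighted x (t : R) := x t / (1 + t ^+ 2).

Lemma measurable_weight_mul (P : R -> R) x (s : R) :
  measurable_fun setT P -> measurable_fun setT x ->
  measurable_fun [set: R] (fun t => x t * P (t - s)).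
Proof.
move=> mP mx; apply: measurable_funM => //; apply: measurableT_comp => //.
exact: measurable_funB.
Qed.

Lemma integrable_mul_poisson x (e s : R) : 0 < e -> measurable_fun setT x ->
  mu.-integrable setT (EFin \o weighted x) ->
  mu.-integrable setT (EFin \o (fun t => x t * poisson e (t - s))).
Proof.
move=> e0 mx iw.
pose c := 2 * e * (2 + (1 + 2 * `|s| ^+ 2) / e ^+ 2).
have ic : mu.-integrable setT (EFin \o (fun t => c * `|weighted x t|)).
  by have := integrableZl measurableT c (integrable_norm iw); apply: eq_integrable.
apply: le_integrable_EFin ic.
  by apply: measurable_weight_mul => //; exact: measurable_poisson.
move=> t; have t2 : 0 < 1 + t ^+ 2 by rewrite ltr_wpDr ?sqr_ge0.
rewrite normrM (ger0_norm (poisson_ge0 _ (ltW e0))) /weighted normrM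
  (gtr0_norm (_ : 0 < _^-1)) ?invr_gt0 //.
rewrite [leRHS]mulrCA ler_wpM2l //; exact: poisson_le_weight.
Qed.

Lemma integrable_of_weighted x (D : set R) (M : R) : measurable D ->
  measurable_fun setT x ->
  mu.-integrable setT (EFin \o weighted x) -> (forall t, D t -> `|t| <= M) ->
  mu.-integrable D (EFin \o x).
Proof.
move=> mD mx iw DM.
have ic : mu.-integrable setT (EFin \o (fun t => (1 + M ^+ 2) * weighted x t)).
  by have := integrableZl measurableT (1 + M ^+ 2) iw; apply: eq_integrable.
have {}ic : mu.-integrable D (EFin \o (fun t => (1 + M ^+ 2) * weighted x t)).
  by apply: integrableS ic.
apply: le_integrable ic => //.
  by apply/measurable_EFinP; exact: measurable_funTS.
move=> t Dt; rewrite /= lee_fin normrM /weighted normrM.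
have t2 : 0 < 1 + t ^+ 2 by rewrite ltr_wpDr ?sqr_ge0.
rewrite [leRHS]mulrCA ler_peMr // (gtr0_norm (_ : 0 < _^-1)) ?invr_gt0 //.
rewrite ger0_norm ?addr_ge0 ?sqr_ge0 // ler_pdivlMr // mul1r lerD //.
by rewrite -(real_normK (num_real t)) lerXn2r ?nnegrE // ?DM // (le_trans _ (DM _ Dt)).
Qed.

Lemma inv_fourier_lt0 x A B (s : R) :
  measurable_fun setT x -> measurable_fun setT A -> measurable_fun setT B ->
  mu.-integrable setT (EFin \o weighted x) ->
  mu.-integrable setT (EFin \o (fun w => `|A w| + `|B w|)) ->
  poisson_formula x A B -> (forall t, t <= 0 -> x t = 0) ->
  s < 0 -> inv_fourier A B s = 0.
Proof.
move=> mx mA mB iw iAB xAB x0 s0.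
have h1 := cvg_damped_inv_fourier (s := s) mA mB iAB.
rewrite -(cvg_lim _ h1) //; apply: cvg_lim => //.
under eq_fun do rewrite xAB ?invr_gt0 //.
(* For [s < 0 < t], [(t - s) ^ 2 >= t ^ 2 + s ^ 2 >= m * (1 + t ^ 2)], so the kernel is at most
   [e * c / (1 + t ^ 2)] and the integral is [O(e)]. *)
pose m := Num.min 1 (s ^+ 2).
have m0 : 0 < m by rewrite lt_min ltr01 exprn_even_gt0 //= lt_eqF.
pose c := 2 / m.
have ic : mu.-integrable setT (EFin \o (fun t => c * `|weighted x t|)).
  by have := integrableZl measurableT c (integrable_norm iw); apply: eq_integrable.
apply: norm_cvg0.
apply: (@squeeze_cvgr _ _ _ _ (cst 0)
  (fun n => n.+1%:R^-1 * \int[mu]_t (c * `|weighted x t|))).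
- apply: nearW => n; rewrite normr_ge0 /= -RintegralZl //.
  have ip : mu.-integrable setT (EFin \o (fun t => x t * poisson n.+1%:R^-1 (t - s))).
    by apply: integrable_mul_poisson; rewrite // invr_gt0.
  rewrite (le_trans (le_normr_Rintegral _ ip)) //.
  apply: le_Rintegral => //.
  + exact: integrable_norm.
  + by have := integrableZl measurableT n.+1%:R^-1 ic; apply: eq_integrable.
  + move=> t _ /=; have t2 : 0 < 1 + t ^+ 2 by rewrite ltr_wpDr ?sqr_ge0.
    have [t0|t0] := leP t 0.
      by rewrite /weighted x0 // !mul0r normr0 !mulr0.
    have P0 : 0 <= poisson n.+1%:R^-1 (t - s) by apply: poisson_ge0; rewrite invr_ge0.
    rewrite normrM (ger0_norm P0) /weighted normrM (gtr0_norm (_ : 0 < _^-1))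
      ?invr_gt0 //.
    rewrite [leRHS](_ : _ = `|x t| * (n.+1%:R^-1 * (c / (1 + t ^+ 2)))); last by ring.
    rewrite ler_wpM2l //.
    have hd : m * (1 + t ^+ 2) <= (t - s) ^+ 2.
      have h3 : m <= 1 by rewrite ge_min lexx.
      have h4 : m <= s ^+ 2 by rewrite ge_min lexx orbT.
      have := sqr_ge0 t; nra.
    apply: (le_trans (poisson_le_dist _ _ hd)); rewrite ?invr_ge0 //.
      by rewrite mulr_gt0.
    rewrite /c invfM le_eqVlt; apply/orP; left; apply/eqP; ring.
- exact: cvg_cst.
- rewrite -[X in _ --> X](mul0r (\int[mu]_t (c * `|weighted x t|))).
  by apply: cvgM; [exact: cvg_harmonic|exact: cvg_cst].
Qed.

(** The Poisson formula at [e = 1 / (n + 1)] is integrated over [s] in [[0, b]], and the limit is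
    computed in both orders: 0 with [s] outside ([lim0]), [2 pi] times the integral sought with [t]
    outside ([lim1]). *)
Lemma integral_itv_eq0 x A B (b : R) :
  measurable_fun setT x -> measurable_fun setT A -> measurable_fun setT B ->
  mu.-integrable setT (EFin \o weighted x) ->
  mu.-integrable setT (EFin \o (fun w => `|A w| + `|B w|)) ->
  poisson_formula x A B -> (forall t, t <= 0 -> x t = 0) ->
  (forall s, inv_fourier A B s = 0) -> 0 < b ->
  \int[mu]_(t in `[0, b]) x t = 0.
Proof.
move=> mx mA mB iw iAB xAB x0 Y0 b0.
pose e n : R := n.+1%:R^-1.
have e0 n : 0 < e n by rewrite invr_gt0.
have e1 n : e n <= 1 by rewrite invf_le1 // ler1n.
pose I0 := `[0, b]%classic.
pose K n t := 2 * (atan (t / e n) - atan ((t - b) / e n)).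
pose f n (st : measurableTypeR R * measurableTypeR R) :=
  \1_I0 st.1 * (x st.2 * poisson (e n) (st.2 - st.1)).
have mI0 : measurable I0 by exact: measurable_itv.
have iI0 : mu.-integrable setT (EFin \o (\1_I0 : R -> R)) by exact: integrable_indic_itv.
have fub n : mu.-integrable setT (EFin \o (fun s => \int[mu]_t f n (s, t))) /\
    \int[mu]_s (\int[mu]_t f n (s, t)) = \int[mu]_t (\int[mu]_s f n (s, t)).
  pose c := 2 * e n * (2 + (1 + 2 * b ^+ 2) / e n ^+ 2).
  apply: (@Rintegral_fubini R (f n) (\1_I0) (fun t => c * `|weighted x t|)) => //.
  - rewrite /f; apply: measurable_funM.
      by apply: measurableT_comp; [exact: measurable_indic|exact: measurable_fst].
    apply: measurable_funM; first by apply: measurableT_comp => //; exact: measurable_snd.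
    apply: measurableT_comp; first exact: measurable_poisson.
    by apply: measurable_funB; [exact: measurable_snd|exact: measurable_fst].
  - by have := integrableZl measurableT c (integrable_norm iw); apply: eq_integrable.
  - move=> s t; rewrite /f /= normrM [X in _ * X]normrM indicE.
    have [sI|sI] := boolP (s \in I0); last by rewrite normr0 !mul0r.
    rewrite normr1 !mul1r (ger0_norm (poisson_ge0 _ (ltW (e0 n)))) /weighted normrM.
    have t2 : 0 < 1 + t ^+ 2 by rewrite ltr_wpDr ?sqr_ge0.
    rewrite (gtr0_norm (_ : 0 < _^-1)) ?invr_gt0 //.
    rewrite [leRHS]mulrCA ler_wpM2l //; apply: poisson_le_weight => //.
    by move: sI; rewrite inE /I0 /= in_itv /= => /andP[s0 sb]; rewrite ger0_norm.
have Gs n s : \int[mu]_t f n (s, t) = \1_I0 s * \int[mu]_t (x t * poisson (e n) (t - s)).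
  by rewrite /f /= -RintegralZl //; apply: integrable_mul_poisson.
have Gt n t : \int[mu]_s f n (s, t) = x t * K n t.
  rewrite /K -Rintegral_poisson_itv // -RintegralZl //; last first.
    exact/continuous_integrable_itv/continuous_poisson_sub.
  rewrite -(Rintegral_indic I0 (fun s => x t * poisson (e n) (t - s))).
  by apply: eq_Rintegral.
have lim0 : \int[mu]_s (\int[mu]_t f n (s, t)) @[n --> \oo] --> (0 : R).
  have -> : 0 = \int[mu]_(s in [set: R]) (cst 0 s) :> R.
    by rewrite Rintegral_cst // mul0r.
  pose c := \int[mu]_w (`|A w| + `|B w|).
  apply: (@Rdominated_cvg R _ _ (fun s => c * \1_I0 s)) => //.
  - by move=> n; have [/measurable_int/measurable_EFinP] := fub n.
  - by have := integrableZl measurableT c iI0; apply: eq_integrable.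
  - apply: aeW => s; rewrite -(mulr0 (\1_I0 s)) -(Y0 s).
    under eq_fun do rewrite Gs -xAB //.
    by apply: cvgM; [exact: cvg_cst|exact: cvg_damped_inv_fourier].
  - move=> n s; rewrite Gs -xAB // normrM [leRHS]mulrC (ger0_norm (_ : 0 <= \1_I0 s))
      ?indicE //.
    by rewrite ler_wpM2l //; apply: norm_damped_inv_fourier_le => //; exact: ltW.
have lim1 : \int[mu]_t (\int[mu]_s f n (s, t)) @[n --> \oo] -->
    \int[mu]_t (\1_I0 t * (2 * pi * x t)).
  pose c := 2 * pi * (1 + (b + 1) ^+ 2) + 2 * b * (3 + 2 * b ^+ 2).
  apply: (@Rdominated_cvg R _ _ (fun t => c * `|weighted x t|)) => //.
  - move=> n; under eq_fun do rewrite Gt; apply: measurable_funM => //.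
    apply: measurable_funM => //; apply: measurable_funB; apply: measurableT_comp.
    + by apply: continuous_measurable_fun => u; exact: continuous_atan.
    + exact: measurable_funM.
    + by apply: continuous_measurable_fun => u; exact: continuous_atan.
    + by apply: measurable_funM => //; exact: measurable_funB.
  - by apply: measurable_funM; [exact: measurable_indic|exact: measurable_funM].
  - by have := integrableZl measurableT c (integrable_norm iw); apply: eq_integrable.
  (* The point [t = b] is excluded: there the second arctangent is 0 and the limit is [pi * x b]
     instead of [2 * pi * x b]. *)
  - have := ae_neq b; apply: filterS; first exact: (ae_filter_ringOfSetsType mu).
    move=> t tb; under eq_fun do rewrite Gt.
    have [t0|t0] := leP t 0.
      rewrite x0 // !mulr0; under eq_fun do rewrite mul0r; exact: cvg_cst.
    have -> : \1_I0 t * (2 * pi * x t) =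
        x t * (2 * (Num.sg t * (pi / 2) - Num.sg (t - b) * (pi / 2))).
      rewrite indicE mem_setE /I0 in_itv /= (ltW t0) /= gtr0_sg //.
      have [tb'|tb'|] := ltgtP t b.
      - by rewrite ltr0_sg ?subr_lt0 //=; field.
      - by rewrite gtr0_sg ?subr_gt0 //=; field.
      - by move/eqP; rewrite (negbTE tb).
    apply: cvgM; first exact: cvg_cst.
    apply: cvgM; first exact: cvg_cst.
    by apply: cvgB; apply: cvg_atan_scale; [rewrite gt_eqF|rewrite subr_eq0].
  - move=> n t; rewrite Gt.
    have [t0|t0] := leP t 0.
      by rewrite /weighted x0 // !mul0r normr0 mulr0.
    have /andP[h1 h2] := atan_diff_bound (e0 n) (e1 n) b0 t0.
    rewrite normrM (ger0_norm h1) /weighted normrM.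
    have t2 : 0 < 1 + t ^+ 2 by rewrite ltr_wpDr ?sqr_ge0.
    rewrite (gtr0_norm (_ : 0 < _^-1)) ?invr_gt0 // [leRHS]mulrCA.
    by rewrite ler_wpM2l.
have fubE : (fun n => \int[mu]_s (\int[mu]_t f n (s, t))) =
    (fun n => \int[mu]_t (\int[mu]_s f n (s, t))).
  by apply/funext => n; have [_ ->] := fub n.
rewrite fubE in lim0.
have : \int[mu]_t (\1_I0 t * (2 * pi * x t)) = 0 by exact: (cvg_unique _ lim1 lim0).
clear fubE lim0 lim1 fub Gs Gt.
rewrite (Rintegral_indic I0 (fun t => 2 * pi * x t)) RintegralZl //; last first.
  apply: (integrable_of_weighted (M := b)) => // t.
  by rewrite /I0 /= in_itv /= => /andP[t0 tb]; rewrite ger0_norm.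
by move/eqP; rewrite mulf_eq0 mulf_eq0 pnatr_eq0 /= gt_eqF ?pi_gt0 //= => /eqP.
Qed.

(** The weight is bounded below on compact sets, so [x] is locally integrable and is almost
    everywhere the derivative of its primitive from 0, which vanishes near every [t > 0]. *)
Lemma ae_eq0_of_integral_itv x : measurable_fun setT x ->
  mu.-integrable setT (EFin \o weighted x) ->
  (forall t, t <= 0 -> x t = 0) ->
  (forall b, 0 < b -> \int[mu]_(t in `[0, b]) x t = 0) -> {ae mu, forall t, x t = 0}.
Proof.
move=> mx iw x0 Ix.
have h1 (y : R) : mu.-integrable [set` Interval (BLeft 0) (BRight y)] (EFin \o x).
  apply: (integrable_of_weighted (M := y)) => //.
  by move=> t; rewrite /= in_itv /= => /andP[t0 ty]; rewrite ger0_norm.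
have h2 : locally_integrable [set: R] x.
  split => //; first exact: openT.
  move=> K _ cK.
  have [M [_ KM]] := compact_bounded cK.
  have := integrable_of_weighted (compact_measurable cK) mx iw (M := M + 1).
  move=> /(_ _)/integrableP[|//].
  by move=> t Kt; apply: KM => //; rewrite ltrDl.
have := FTC1 h1 h2; apply: filterS; first exact: (ae_filter_ringOfSetsType mu).
move=> t; have [t0 _|t0] := leP t 0; first exact: x0.
have lt0t : (BLeft (0 : R)%R < BRight t)%E by rewrite ?bnd_simp ?ltW ?ltNyr.
move=> /(_ lt0t)[_ <-].
rewrite derive1E (@near_eq_derive _ _ _ _ (cst 0)) ?derive_cst //.
near=> s; apply: Ix; near: s; exact: lt_nbhsr.
Unshelve. all: by end_near. Qed.

Lemma ae_eq0_of_poisson_formula x A B (r : R) : 0 < r ->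
  measurable_fun setT x -> measurable_fun setT A -> measurable_fun setT B ->
  mu.-integrable setT (EFin \o weighted x) ->
  mu.-integrable setT (EFin \o (fun w => expR (r * `|w|) * (`|A w| + `|B w|))) ->
  poisson_formula x A B -> {ae mu, forall t, t < 0 -> x t = 0} ->
  {ae mu, forall t, x t = 0}.
Proof.
move=> r0 mx mA mB iw irAB xAB xN.
have iAB : mu.-integrable setT (EFin \o (fun w => `|A w| + `|B w|)).
  apply: le_integrable_EFin irAB.
    by apply: measurable_funD; exact: measurableT_comp.
  move=> w; rewrite ger0_norm ?addr_ge0 // ler_peMl ?addr_ge0 //.
  by rewrite -expR0 ler_expR mulr_ge0 // ltW.
(* [y] equals [x] almost everywhere and vanishes at every [t <= 0], the origin included; the Poisson
   formula sees [x] only through an integral, so it passes to [y] with the same [A] and [B]. *)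
pose y t := x t * \1_(`]0, +oo[%classic : set R) t.
have xy : {ae mu, forall t, x t = y t}.
  have := ae_neq 0 (R := R); have := xN; apply: filterS2;
    first exact: (ae_filter_ringOfSetsType mu).
  move=> t xt t0; rewrite /y indicE mem_setE in_itv /= andbT.
  have [_|t0'|/eqP] := ltgtP 0 t; first by rewrite mulr1.
  - by rewrite mulr0 xt.
  - by rewrite eq_sym (negbTE t0).
have my : measurable_fun setT y.
  by apply: measurable_funM => //; exact: measurable_indic.
have y0 t : t <= 0 -> y t = 0.
  by move=> t0; rewrite /y indicE mem_setE in_itv /= andbT ltNge t0 mulr0.
have iy : mu.-integrable setT (EFin \o weighted y).
  apply: le_integrable_EFin (integrable_norm iw).
    have -> : weighted y = (fun t => weighted x t * \1_(`]0, +oo[%classic : set R) t).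
      by apply/funext => t; rewrite /weighted /y mulrAC.
    apply: measurable_funM; last exact: measurable_indic.
    by apply/measurable_EFinP; exact: (measurable_int mu iw).
  move=> t; rewrite /= /weighted /y !normrM ler_wpM2r // ler_piMr // indicE.
  by case: (_ \in _); rewrite ?normr1 ?normr0.
have yAB : poisson_formula y A B.
  move=> e s e0; rewrite xAB // /Rintegral; congr fine.
  apply: ae_eq_integral => //.
  - by apply/measurable_EFinP; apply: measurable_weight_mul => //;
      exact: measurable_poisson.
  - by apply/measurable_EFinP; apply: measurable_weight_mul => //;
      exact: measurable_poisson.
  - move: xy; apply: filterS; first exact: (ae_filter_ringOfSetsType mu).
    by move=> t xt _; rewrite xt.
have Y0 : forall s, inv_fourier A B s = 0.
  apply: (inv_fourier_eq0 r0 mA mB irAB) => s; exact: inv_fourier_lt0 yAB y0.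
have : {ae mu, forall t, y t = 0}.
  apply: ae_eq0_of_integral_itv => // b b0; exact: integral_itv_eq0 yAB y0 Y0 b0.
have := xy; apply: filterS2; first exact: (ae_filter_ringOfSetsType mu).
by move=> t -> .
Qed.

End poisson_representation.

(** * The Poisson formula for the Fourier transform *)

Section fourier_L1.
Context {R : realType}.
Local Notation mu := (@lebesgue_measure R).
Implicit Types (A B f g h x : R -> R) (F D : nat -> R -> R).

Lemma Re_fourier1 x w : complex.Re (fourier1 x w) = \int[mu]_t (x t * cos (w * t)).
Proof. by apply: eq_Rintegral => t _; rewrite /= mulr0 subr0 mulrC. Qed.

Section L1.
Variable x : R -> R.
Hypothesis ix : mu.-integrable setT (EFin \o x).
Let mx : measurable_fun setT x.
Proof. by apply/measurable_EFinP; exact: (measurable_int mu ix). Qed.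

Let integrable_kernel (c : R -> R) w : measurable_fun setT c -> (forall t, `|c t| <= 1) ->
  mu.-integrable setT (EFin \o (fun t => x t * c (w * t))).
Proof.
move=> mc c1; apply: le_integrable_EFin (integrable_norm ix).
  by apply: measurable_funM => //; apply: measurableT_comp => //; exact: measurable_funM.
by move=> t; rewrite normrM ler_piMr.
Qed.

Lemma Im_fourier1 w : complex.Im (fourier1 x w) = - \int[mu]_t (x t * sin (w * t)).
Proof.
rewrite -mulN1r -RintegralZl //; last first.
  apply: integrable_kernel; first by apply: continuous_measurable_fun;
    exact: continuous_sin.
  by move=> t; rewrite ler_norml sin_geN1 sin_le1.
by apply: eq_Rintegral => t _; rewrite /= mulr0 add0r mulNr mulN1r mulrC.
Qed.

(** [c] stands for cosine or sine. Damping supplies the product majorant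
    [expR (- (e * |w|)) * |x t|] that Fubini's theorem needs. *)
Lemma fubini_damped (c : R -> R) (e s : R) : 0 < e ->
  measurable_fun setT c -> (forall t, `|c t| <= 1) ->
  mu.-integrable setT (EFin \o
    (fun w => expR (- (e * `|w|)) * \int[mu]_t (x t * c (w * (t - s))))) /\
  \int[mu]_w (expR (- (e * `|w|)) * \int[mu]_t (x t * c (w * (t - s)))) =
  \int[mu]_t (x t * \int[mu]_w (expR (- (e * `|w|)) * c (w * (t - s)))).
Proof.
move=> e0 mc c1.
pose f (wt : measurableTypeR R * measurableTypeR R) :=
  expR (- (e * `|wt.1|)) * (x wt.2 * c (wt.1 * (wt.2 - s))).
have E w : \int[mu]_t f (w, t) = expR (- (e * `|w|)) * \int[mu]_t (x t * c (w * (t - s))).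
  rewrite /f /= RintegralZl //; apply: le_integrable_EFin (integrable_norm ix).
    apply: measurable_funM => //; apply: measurableT_comp => //;
      apply: measurable_funM => //.
    exact: measurable_funB.
  by move=> t; rewrite normrM ler_piMr.
have mf : measurable_fun setT f.
  apply: measurable_funM.
    by apply: (measurableT_comp (measurable_exp_abs e)); exact: measurable_fst.
  apply: measurable_funM; first by apply: measurableT_comp => //; exact: measurable_snd.
  apply: measurableT_comp => //; apply: measurable_funM; first exact: measurable_fst.
  by apply: measurable_funB => //; exact: measurable_snd.
have le w t : `|f (w, t)| <= expR (- (e * `|w|)) * `|x t|.
  rewrite /f /= normrM (ger0_norm (expR_ge0 _)) ler_wpM2l ?expR_ge0 // normrM ler_piMr //.
have [h1 h2] := Rintegral_fubini mf (integrable_exp e0) (integrable_norm ix) le.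
split.
  by apply: eq_integrable h1 => // w _ /=; rewrite E.
under eq_Rintegral do rewrite -E.
rewrite h2; apply: eq_Rintegral => t _.
rewrite -RintegralZl //.
  by apply: eq_Rintegral => w _; rewrite /f /= mulrCA.
apply: le_integrable_EFin (integrable_exp e0).
  apply: measurable_funM; first exact: measurable_exp_abs.
  by apply: measurableT_comp => //; exact: measurable_funM.
by move=> w; rewrite normrM (ger0_norm (expR_ge0 _)) ler_piMr ?expR_ge0.
Qed.

(** Fubini's theorem gives measurability of the damped transform; multiplying by [expR |w|] undoes
    the damping taken at [e = 1], [s = 0]. *)
Lemma measurable_fourier_kernel (c : R -> R) : measurable_fun setT c ->
  (forall t, `|c t| <= 1) ->
  measurable_fun [set: R] (fun w => \int[mu]_t (x t * c (w * t))).
Proof.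
move=> mc c1; have [+ _] := fubini_damped 0 ltr01 mc c1.
move=> /measurable_int/measurable_EFinP m.
have -> : (fun w => \int[mu]_t (x t * c (w * t))) =
  (fun w => expR `|w| * (expR (- (1 * `|w|)) * \int[mu]_t (x t * c (w * (t - 0))))).
  apply/funext => w; rewrite mulrA -expRD mul1r subrr expR0 mul1r.
  by apply: eq_Rintegral => t _; rewrite subr0.
by apply: measurable_funM => //; exact: measurableT_comp.
Qed.

Lemma measurable_Re_fourier1 : measurable_fun setT (fun w => complex.Re (fourier1 x w)).
Proof.
under eq_fun do rewrite Re_fourier1; apply: measurable_fourier_kernel.
  apply: continuous_measurable_fun; exact: continuous_cos.
by move=> t; rewrite ler_norml cos_geN1 cos_le1.
Qed.

Lemma measurable_Im_fourier1 : measurable_fun setT (fun w => complex.Im (fourier1 x w)).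
Proof.
under eq_fun do rewrite Im_fourier1; apply: measurableT_comp => //;
  apply: measurable_fourier_kernel.
  apply: continuous_measurable_fun; exact: continuous_sin.
by move=> t; rewrite ler_norml sin_geN1 sin_le1.
Qed.

(** The cosine of a difference turns the trigonometric combination into the integral of
    [x t * cos (w * (t - s))]; Fubini and [Rintegral_exp_cos] then produce the kernel. The
    integrability clause serves linearity in the passage to L2. *)
Lemma poisson_formula_fourier1 :
  poisson_formula x (fun w => complex.Re (fourier1 x w))
    (fun w => complex.Im (fourier1 x w)) /\
  forall e s, 0 < e -> mu.-integrable setT (EFin \o (fun w => expR (- (e * `|w|)) *
     (complex.Re (fourier1 x w) * cos (w * s)
      - complex.Im (fourier1 x w) * sin (w * s)))).
Proof.
have mc : measurable_fun [set: R] cos by apply: continuous_measurable_fun;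
  exact: continuous_cos.
have ms : measurable_fun [set: R] sin by apply: continuous_measurable_fun;
  exact: continuous_sin.
have c1 (t : R) : `|cos t| <= 1 by rewrite ler_norml cos_geN1 cos_le1.
have s1 (t : R) : `|sin t| <= 1 by rewrite ler_norml sin_geN1 sin_le1.
have E w s : complex.Re (fourier1 x w) * cos (w * s)
    - complex.Im (fourier1 x w) * sin (w * s) =
    \int[mu]_t (x t * cos (w * (t - s))).
  rewrite Re_fourier1 Im_fourier1 mulNr opprK.
  rewrite -!RintegralZr //; [|exact: integrable_kernel..].
  rewrite -RintegralD //.
  - by apply: eq_Rintegral => t _; rewrite mulrBr cosB mulrDr !mulrA.
  - by have := integrableZr measurableT (cos (w * s)) (integrable_kernel w mc c1);
      apply: eq_integrable.
  - by have := integrableZr measurableT (sin (w * s)) (integrable_kernel w ms s1);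
      apply: eq_integrable.
split=> e s e0.
- under eq_Rintegral do rewrite E.
  have [_ ->] := fubini_damped s e0 mc c1.
  by apply: eq_Rintegral => t _; rewrite Rintegral_exp_cos.
- have [h _] := fubini_damped s e0 mc c1.
  by apply: eq_integrable h => // w _ /=; rewrite E.
Qed.
End L1.

End fourier_L1.

(** * The Fourier transform on L2, by passage to the limit *)

Section fourier_L2.
Context {R : realType}.
Local Notation mu := (@lebesgue_measure R).
Implicit Types (A B f g h x : R -> R) (F D : nat -> R -> R).

Lemma integrable_oneDsqrV : mu.-integrable setT (EFin \o (fun t : R => (1 + t ^+ 2)^-1)).
Proof.
have t2 (t : R) : 0 < 1 + t ^+ 2 by rewrite ltr_wpDr ?sqr_ge0.
have c : continuous (fun t : R => (1 + t ^+ 2)^-1) by exact: continuous_oneDsqrV.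
apply/integrableP; split; first by apply/measurable_EFinP;
  exact: continuous_measurable_fun.
apply: le_lt_trans (ltry pi); rewrite le_eqVlt; apply/orP; left; apply/eqP.
under eq_integral => t _ do rewrite /= gtr0_norm ?invr_gt0 //.
rewrite (@ge0_symfun_integralT R (fun t => (1 + t ^+ 2)^-1)) //.
- rewrite -set_itvcy; have := @integral0y_oneDsqr R; rewrite /oneDsqr => ->.
  by rewrite -EFinM; congr EFin; field.
- by move=> t; rewrite invr_ge0 ltW.
- by move=> t; rewrite /= sqrrN.
Qed.

Lemma Lfun2_measurable f : f \in Lfun mu 2%:E -> measurable_fun setT f.
Proof. by rewrite inE => /andP[/[!inE]]. Qed.

Lemma Lfun2_of_integrable_sqr f : measurable_fun setT f ->
  mu.-integrable setT (EFin \o (fun t => f t ^+ 2)) -> f \in Lfun mu 2%:E.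
Proof.
move=> mf if2; rewrite inE; apply/andP; split; rewrite inE //=.
rewrite /finite_norm unlock; apply: poweR_lty.
have := integrable_lty measurableT if2; congr (_ < _)%E.
by apply: eq_integral => t _ /=; rewrite powR_mulrn // real_normK // num_real.
Qed.

Lemma Lfun2_le_inv x (c : R) : measurable_fun setT x ->
  (forall t, `|x t| <= c / (1 + t ^+ 2)) ->
  x \in Lfun mu 2%:E.
Proof.
move=> mx xc; apply: Lfun2_of_integrable_sqr => //.
have : mu.-integrable setT (EFin \o (fun t : R => c ^+ 2 * (1 + t ^+ 2)^-1)).
  by have := integrableZl measurableT (c ^+ 2) integrable_oneDsqrV; apply: eq_integrable.
apply: le_integrable_EFin; first exact: measurable_funX.
move=> t; have t2 : 1 <= 1 + t ^+ 2 by rewrite lerDl sqr_ge0.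
rewrite normrX (@le_trans _ _ ((c / (1 + t ^+ 2)) ^+ 2)) //.
  by rewrite lerXn2r ?nnegrE // (le_trans _ (xc t)).
rewrite expr_div_n ler_wpM2l ?sqr_ge0 // lef_pV2 ?posrE ?exprn_gt0 ?(lt_le_trans _ t2) //.
by rewrite expr2 ler_peMl // (le_trans _ t2).
Qed.

Lemma Lfun2_exp (c e : R) : 0 < e -> (fun w : R => c * expR (- (e * `|w|))) \in Lfun
  mu 2%:E.
Proof.
move=> e0; apply: Lfun2_of_integrable_sqr.
  by apply: measurable_funM => //; exact: measurable_exp_abs.
have := integrableZl measurableT (c ^+ 2) (integrable_exp (_ : 0 < 2 * e)).
move=> /(_ (mulr_gt0 (ltr0Sn _ 1) e0)); apply: eq_integrable => //.
by move=> w _ /=; rewrite exprMn -expRM_natl -EFinM; congr (_ * expR _)%:E; ring.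
Qed.

Lemma Lfun2_poisson (e s : R) : 0 < e -> (fun t => poisson e (t - s)) \in Lfun mu 2%:E.
Proof.
move=> e0; pose c := 2 * e * (2 + (1 + 2 * `|s| ^+ 2) / e ^+ 2).
apply: (@Lfun2_le_inv _ c).
  by apply: measurableT_comp; [exact: measurable_poisson|exact: measurable_funB].
by move=> t; rewrite ger0_norm ?poisson_ge0 ?(ltW e0) //; exact: poisson_le_weight.
Qed.

Lemma integrable_weighted1 x : mu.-integrable setT (EFin \o x) ->
  mu.-integrable setT (EFin \o weighted x).
Proof.
move=> ix; have mx : measurable_fun setT x by apply/measurable_EFinP;
  exact: (measurable_int mu ix).
apply: le_integrable_EFin (integrable_norm ix).
  apply: measurable_funM => //; apply: continuous_measurable_fun;
    exact: continuous_oneDsqrV.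
move=> t; rewrite normrM ler_piMr // gtr0_norm ?invr_gt0 ?ltr_wpDr ?sqr_ge0 //.
by rewrite invf_le1 ?lerDl ?sqr_ge0 // ltr_wpDr ?sqr_ge0.
Qed.

Lemma integrable_weighted2 x : x \in Lfun mu 2%:E ->
  mu.-integrable setT (EFin \o weighted x).
Proof.
move=> x2; apply/Lfun1_integrable; apply: Lfun2_mul_Lfun1 => //.
apply: (@Lfun2_le_inv _ 1); first by apply: continuous_measurable_fun;
  exact: continuous_oneDsqrV.
by move=> t; rewrite mul1r gtr0_norm // invr_gt0 ltr_wpDr ?sqr_ge0.
Qed.

(** Hoelder's inequality with exponents 2 and 2. A bound by [|D n * h|] is asked instead of an
    equality, so that [D n] may be the modulus of a complex difference. *)
Lemma cvg_L2_pairing D h F : h \in Lfun mu 2%:E ->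
  (forall n, measurable_fun setT (D n)) -> (forall n, measurable_fun setT (F n)) ->
  (forall n t, `|F n t| <= `|D n t * h t|) ->
  'N[mu]_2%:E[EFin \o D n]%E @[n --> \oo] --> 0%E ->
  \int[mu]_t F n t @[n --> \oo] --> 0.
Proof.
move=> h2 mD mF Fle D0.
have mh := Lfun2_measurable h2.
have hfin : ('N[mu]_2%:E[EFin \o h] \is a fin_num)%E.
  rewrite ge0_fin_numE ?Lnorm_ge0 //.
  by move: h2; rewrite inE => /andP[_]; rewrite inE.
apply: fine_cvg; apply/cvg_abse0P.
apply: (@squeeze_cvge _ _ _ _ (cst 0%E) _
  (fun n => 'N[mu]_2%:E[EFin \o D n] * 'N[mu]_2%:E[EFin \o h])%E).
- apply: nearW => n; rewrite abse_ge0 /=.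
  have mFn : measurable_fun setT (EFin \o F n) by exact/measurable_EFinP.
  apply: (le_trans (le_abse_integral mu measurableT mFn)).
  have h12 : 2^-1 + 2^-1 = 1 :> R by lra.
  apply: le_trans (hoelder mu (mD n) mh (ltr0Sn _ 1) (ltr0Sn _ 1) h12).
  rewrite Lnorm1; apply: ge0_le_integral => //.
  + exact: measurableT_comp.
  + apply: measurableT_comp => //; apply/measurable_EFinP.
    by apply: measurable_funM => //; exact: mD.
  + by move=> t _; rewrite /= lee_fin.
- exact: cvg_cst.
- by rewrite -[X in _ --> X](mul0e ('N[mu]_2%:E[EFin \o h])%E); exact: cvgeZr.
Qed.

Lemma normc_sqrtE (z : R[i]) : Normc.normc z = Num.sqrt
  (complex.Re z ^+ 2 + complex.Im z ^+ 2).
Proof. by case: z. Qed.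

Lemma norm_Re_le (z : R[i]) : `|complex.Re z| <= Normc.normc z.
Proof. by rewrite normc_sqrtE -sqrtr_sqr ler_sqrt ?addr_ge0 ?sqr_ge0 //
  lerDl sqr_ge0. Qed.

Lemma norm_Im_le (z : R[i]) : `|complex.Im z| <= Normc.normc z.
Proof. by rewrite normc_sqrtE -sqrtr_sqr ler_sqrt ?addr_ge0 ?sqr_ge0 //
  lerDr sqr_ge0. Qed.

Lemma ReB (z y : R[i]) : complex.Re (z - y) = complex.Re z - complex.Re y.
Proof. by case: z; case: y. Qed.

Lemma ImB (z y : R[i]) : complex.Im (z - y) = complex.Im z - complex.Im y.
Proof. by case: z; case: y. Qed.

(** For fixed [e] and [s] both sides are continuous in L2 norm: one pairs [x] with the Poisson
    kernel, the other pairs [X] with a damped exponential, and both kernels are in L2. *)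
Lemma poisson_formula_fourier2 x (X : R -> R[i]) : is_fourier2 x X ->
  poisson_formula x (fun w => complex.Re (X w)) (fun w => complex.Im (X w)).
Proof.
move=> [x2 [A2 B2] [u [u12 ux uX]]] e s e0.
have mx := Lfun2_measurable x2.
have mA := Lfun2_measurable A2; have mB := Lfun2_measurable B2.
have mun n : measurable_fun setT (u n) by apply: Lfun2_measurable; case: (u12 n).
have iu n : mu.-integrable setT (EFin \o u n) by apply/Lfun1_integrable; case: (u12 n).
pose a n w := complex.Re (fourier1 (u n) w); pose b n w := complex.Im (fourier1 (u n) w).
have ma n : measurable_fun setT (a n) by exact: measurable_Re_fourier1.
have mb n : measurable_fun setT (b n) by exact: measurable_Im_fourier1.
pose g A B w := expR (- (e * `|w|)) * (A w * cos (w * s) - B w * sin (w * s)).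
have mg A B : measurable_fun setT A -> measurable_fun setT B ->
  measurable_fun setT (g A B).
  by move=> mA' mB'; apply: measurable_funM;
    [exact: measurable_exp_abs|exact: measurable_trig_comb].
have ig n : mu.-integrable setT (EFin \o g (a n) (b n)).
  by have [_ ->] := poisson_formula_fourier1 (iu n).
pose A w := complex.Re (X w); pose B w := complex.Im (X w).
have igX : mu.-integrable setT (EFin \o g A B).
  have h1 : mu.-integrable setT (EFin \o (fun w => expR (- (e * `|w|)) * A w)).
    apply/Lfun1_integrable; apply: Lfun2_mul_Lfun1 => //.
    by have := Lfun2_exp 1 e0; under eq_fun do rewrite mul1r.
  have h2 : mu.-integrable setT (EFin \o (fun w => expR (- (e * `|w|)) * B w)).
    apply/Lfun1_integrable; apply: Lfun2_mul_Lfun1 => //.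
    by have := Lfun2_exp 1 e0; under eq_fun do rewrite mul1r.
  have h3 := integrableD measurableT (integrable_norm h1) (integrable_norm h2).
  apply: (@le_integrable_EFin R _
    (fun w => `|expR (- (e * `|w|)) * A w| + `|expR (- (e * `|w|)) * B w|)) => //.
    exact: mg.
  move=> w; rewrite !normrM -mulrDr ler_wpM2l //; exact: norm_trig_comb_le.
have ipu n : mu.-integrable setT (EFin \o (fun t => u n t * poisson e (t - s))).
  by apply: integrable_mul_poisson => //; exact: integrable_weighted1.
have ipx : mu.-integrable setT (EFin \o (fun t => x t * poisson e (t - s))).
  by apply: integrable_mul_poisson => //; exact: integrable_weighted2.
have lim1 : \int[mu]_t ((u n t - x t) * poisson e (t - s)) @[n --> \oo] --> 0.
  apply: (cvg_L2_pairing (D := fun n t => u n t - x t) (Lfun2_poisson s e0)) => //.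
  - by move=> n; exact: measurable_funB.
  - move=> n; apply: measurable_funM; first exact: measurable_funB.
    exact: Lfun2_measurable (Lfun2_poisson s e0).
(* The factor 2 in [Lfun2_exp 2 e0] comes from [|Re d| + |Im d| <= 2 |d|]. *)
have lim2 : \int[mu]_w (g (a n) (b n) w - g A B w) @[n --> \oo] --> 0.
  apply: (cvg_L2_pairing (D := fun n w => Normc.normc (fourier1 (u n) w - X w))
    (Lfun2_exp 2 e0)) => //.
  - move=> n; under eq_fun do rewrite normc_sqrtE ReB ImB.
    apply: measurableT_comp; first by apply: continuous_measurable_fun;
      exact: sqrt_continuous.
    apply: measurable_funD; apply: measurable_funX; apply: measurable_funB => //;
      [exact: ma|exact: mb].
  - by move=> n; apply: measurable_funB; exact: mg.
  - move=> n w; set d := fourier1 (u n) w - X w.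
    have -> : g (a n) (b n) w - g A B w =
        expR (- (e * `|w|)) * (complex.Re d * cos (w * s) - complex.Im d * sin (w * s)).
      by rewrite /g /d ReB ImB /a /b /A /B; ring.
    rewrite normrM mulrCA mulrA normrM [leRHS]mulrC ler_wpM2l //.
    rewrite (le_trans (norm_trig_comb_le _ _ _)) // (le_trans _ (ler_norm _)) //.
    by have := norm_Re_le d; have := norm_Im_le d; lra.
have E n : \int[mu]_t (u n t * poisson e (t - s)) = \int[mu]_w g (a n) (b n) w.
  by have [h _] := poisson_formula_fourier1 (iu n); rewrite -h.
(* By the formula for [u n] the terms in [u n] cancel: this sequence is constant, equal to the gap
   between the two sides for [x], so its limit 0 is that gap. *)
have lim3 : \int[mu]_t ((u n t - x t) * poisson e (t - s)) -
    \int[mu]_w (g (a n) (b n) w - g A B w) @[n --> \oo] --> 0.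
  by rewrite -[X in _ --> X](subrr 0); exact: cvgB lim1 lim2.
apply/eqP; rewrite -subr_eq0; apply/eqP.
rewrite -(cvg_lim _ lim3) //; apply/esym/cvg_lim => //.
apply: cvg_near_cst; apply: nearW => n /=.
under [X in X - _ = _]eq_Rintegral do rewrite mulrBl.
by rewrite RintegralB // RintegralB // E; ring.
Qed.

End fourier_L2.

(** * The class X(2) and the conclusion *)

Section main.
Context {R : realType}.
Local Notation mu := (@lebesgue_measure R).
Implicit Types (A B f g h x : R -> R) (F D : nat -> R -> R).

Lemma is_fourier_poisson_formula x (X : R -> R[i]) : is_fourier x X ->
  [/\ measurable_fun setT x, measurable_fun setT (fun w => complex.Re (X w)),
      measurable_fun setT (fun w => complex.Im (X w)),
      mu.-integrable setT (EFin \o weighted x) &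
      poisson_formula x (fun w => complex.Re (X w)) (fun w => complex.Im (X w))].
Proof.
case=> [[/Lfun1_integrable ix ->]|fX].
  split.
  - by apply/measurable_EFinP; exact: (measurable_int mu ix).
  - exact: measurable_Re_fourier1.
  - exact: measurable_Im_fourier1.
  - exact: integrable_weighted1.
  - by have [] := poisson_formula_fourier1 ix.
have [x2 [A2 B2] _] := fX; split; try exact: Lfun2_measurable.
- exact: integrable_weighted2.
- exact: poisson_formula_fourier2.
Qed.

(** The class gives a weighted L2 bound with rate [2 T], while [ae_eq0_of_poisson_formula] asks for
    a weighted L1 bound. Splitting [e^(T|w|/2)] as [e^(-T|w|/2) * e^(T|w|)] leaves a
    square-integrable factor, whence the rate [T / 2]. *)
Lemma classX2_ae_eq0 x : classX2 x ->
  {ae mu, forall t, t < 0 -> x t = 0} -> {ae mu, forall t, x t = 0}.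
Proof.
move=> [T /= T0 [X fX Xoo]].
have [mx mA mB iw xAB] := is_fourier_poisson_formula fX.
move: xAB mA mB; set A := (fun w => complex.Re _); set B :=
  (fun w => complex.Im _) => xAB mA mB.
apply: (@ae_eq0_of_poisson_formula R x A B (T / 2)) => //; first by rewrite divr_gt0.
have E w : expR (2 * T * `|w|) * Normc.normc (X w) ^+ 2 =
    expR (2 * T * `|w|) * (A w ^+ 2 + B w ^+ 2).
  by rewrite normc_sqrtE sqr_sqrtr // addr_ge0 ?sqr_ge0.
have mAB : measurable_fun setT (fun w : R => expR (2 * T * `|w|) * (A w ^+ 2 + B w ^+ 2)).
  apply: measurable_funM.
    by apply: measurableT_comp => //; exact: measurable_funM.
  by apply: measurable_funD; exact: measurable_funX.
have iX : mu.-integrable setT (EFin \o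
  (fun w => expR (2 * T * `|w|) * (A w ^+ 2 + B w ^+ 2))).
  apply/integrableP; split; first exact/measurable_EFinP.
  apply: le_lt_trans Xoo; rewrite le_eqVlt; apply/orP; left; apply/eqP.
  apply: eq_integral => w _; rewrite E /= ger0_norm //.
  by rewrite mulr_ge0 ?expR_ge0 // addr_ge0 ?sqr_ge0.
have iE := integrable_exp T0.
have h := integrableD measurableT iE iX.
apply: (@le_integrable_EFin R _
  (fun w => expR (- (T * `|w|)) + expR (2 * T * `|w|) * (A w ^+ 2 + B w ^+ 2))) => //.
  apply: measurable_funM.
    by apply: measurableT_comp => //; exact: measurable_funM.
  by apply: measurable_funD; exact: measurableT_comp.
move=> w; rewrite ger0_norm; last by rewrite mulr_ge0 ?expR_ge0 // addr_ge0.
(* AM-GM: [2 p (q |A|) <= p^2 + q^2 |A|^2], and the same for [B] *)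
set p := expR (- (T / 2 * `|w|)); set q := expR (T * `|w|).
have -> : expR (- (T * `|w|)) = p ^+ 2 by rewrite /p -expRM_natl; congr expR; field.
have -> : expR (2 * T * `|w|) = q ^+ 2 by rewrite /q -expRM_natl mulrA.
have -> : expR (T / 2 * `|w|) = p * q by rewrite /p /q -expRD; congr expR; field.
have := sqr_ge0 (p - q * `|A w|); have := sqr_ge0 (p - q * `|B w|).
rewrite -(real_normK (num_real (A w))) -(real_normK (num_real (B w))).
nra.
Qed.

End main.

(** Functions in M and N are smooth, so for them vanishing is pointwise; members of X(2) stand for
    classes modulo null sets, so there it is almost everywhere. *)
Theorem theorem1 (R : realType) (x : R -> R) :
  ((classM `|` classN) x ->
     (forall t : R, t < 0 -> x t = 0) -> forall t : R, x t = 0) /\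
  (classX2 x ->
     {ae @lebesgue_measure R, forall t : R, t < 0 -> x t = 0} ->
     {ae @lebesgue_measure R, forall t : R, x t = 0}).
Proof.
split; last exact: classX2_ae_eq0.
by case=> [xM|xN] x0; [exact: classM_eq0|exact: classN_eq0].
Qed.
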